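(* Let $f:G\to\mathbb{C}$ be a bounded measurable function, and let $\mathcal{A}=(A_n)$ be a van Hove sequence on $G$. Then the following assertions are equivalent: (i) $f$ is Weyl almost periodic with respect to $\mathcal{A}$. (ii) For each $\chi\in\widehat{G}$ the Fourier--Bohr coefficient $a_\chi^{\mathcal{A}}(f)=\lim_{n\to\infty}\frac{1}{|A_n|}\int_{A_n+s}f(t)\,\overline{\chi(t)}\,\mathrm{d}t$ and the limit $\lim_{n\to\infty}\frac{1}{|A_n|}\int_{A_n+s}|f(t)|^2\,\mathrm{d}t=M(|f|^2)$ exist uniformly in $s\in G$, and they satisfy the Parseval identity $\sum_{\chi\in\widehat{G}}|a_\chi^{\mathcal{A}}(f)|^2=M(|f|^2)$. (iii) For each van Hove sequence $\mathcal{B}=(B_n)$ and each $\chi\in\widehat{G}$ the Fourier--Bohr coefficient $a_\chi^{\mathcal{B}}(f)=\lim_{n\to\infty}\frac{1}{|B_n|}\int_{B_n}f(t)\,\overline{\chi(t)}\,\mathrm{d}t$ and the limit $\lim_{n\to\infty}\frac{1}{|B_n|}\int_{B_n}|f(t)|^2\,\mathrm{d}t=M_{\mathcal{B}}(|f|^2)$ exist, and they satisfy the Parseval identity $\sum_{\chi\in\widehat{G}}|a_\chi^{\mathcal{B}}(f)|^2=M_{\mathcal{B}}(|f|^2)$. (iv) $f$ is Besicovitch $2$-almost periodic with respect to every van Hove sequence $\mathcal{B}$. In particular, any bounded function which is Weyl almost periodic with respect to $\mathcal{A}$ is amenable.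
   Context: $G$ is a locally compact (Hausdorff), $\sigma$-compact abelian group with Haar measure $\theta_G$; $|A|=\theta_G(A)$, and $\mathrm{d}t$ denotes integration against $\theta_G$. $\widehat{G}$ is the dual group. A van Hove sequence $\mathcal{A}=(A_n)$ is a sequence of relatively compact open sets (of positive measure) with $|\partial^K A_n|/|A_n|\to 0$ for every compact $K\subseteq G$, where $\partial^K A=\big(\overline{A+K}\cap\overline{A^c}\big)\cup\big(\overline{A^c-K}\cap\overline{A}\big)$. A trigonometric polynomial is a finite linear combination of characters. $f\in\mathcal{L}^1_{loc}(G)$ is Weyl almost periodic with respect to $\mathcal{A}$ if for each $\varepsilon>0$ there is a trigonometric polynomial $P$ with $\limsup_n\sup_{x\in G}\frac{1}{|A_n|}\int_{x+A_n}|f(t)-P(t)|\,\mathrm{d}t<\varepsilon$. $f\in\mathcal{L}^2_{loc}(G)$ is Besicovitch $2$-almost periodic with respect to $\mathcal{B}$ if for each $\varepsilon>0$ there is a trigonometric polynomial $P$ with $\limsup_n\big(\frac{1}{|B_n|}\int_{B_n}|f(t)-P(t)|^2\,\mathrm{d}t\big)^{1/2}<\varepsilon$. A bounded measurable function $f$ is amenable if $\lim_n\frac{1}{|A_n|}\int_{s+A_n}f(t)\,\mathrm{d}t$ exists uniformly in $s\in G$ for one (equivalently every) van Hove sequence. *)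

(* Defs.v *)
From HB Require Import structures.
From mathcomp Require Import all_boot all_order all_algebra.
From mathcomp Require Import all_classical all_reals all_analysis.
From mathcomp Require Import complex.

Set Implicit Arguments.
Unset Strict Implicit.
Unset Printing Implicit Defensive.

Import Order.TTheory GRing.Theory Num.Theory.
Import numFieldTopology.Exports numFieldNormedType.Exports.

Local Open Scope classical_set_scope.
Local Open Scope ring_scope.
Local Open Scope complex_scope.

(* [borel G] is convertible to [G] and carries the Borel sigma-algebra. The
   library's [g_sigma_algebraType] only gets its measurable structure on a
   pointed type, which a [topologicalZmodType] is not. *)
Definition borel (G : topologicalZmodType) : Type := G.

Section borel_instance.
Variable G : topologicalZmodType.

HB.instance Definition _ := Choice.copy (borel G) G.
HB.instance Definition _ := isPointed.Build (borel G) (0 : G).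

Lemma borel_setC (A : set (borel G)) :
  <<s @open G >> A -> <<s @open G >> (~` A).
Proof. by move=> sA; rewrite -setTD; exact: sigma_algebraCD. Qed.

HB.instance Definition _ := @isMeasurable.Build (sigma_display (@open G))
  (borel G) <<s @open G >> (@sigma_algebra0 _ setT (@open G)) borel_setC
  (@sigma_algebra_bigcup _ setT (@open G)).

End borel_instance.

Notation cabs := ComplexField.Normc.normc.

Section topological_group.
Variables (R : realType) (G : topologicalZmodType).
Implicit Types (A K : set G) (f P chi : G -> R[i]).

Definition sigma_compact :=
  exists2 K : (set G)^nat, (forall n, compact (K n)) & \bigcup_n K n = setT.

Definition translate (x : G) A : set G := [set x + a | a in A].

Definition van_hove_boundary K A : set G :=
  (closure [set a + k | a in A & k in K] `&` closure (~` A)) `|`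
  (closure [set b - k | b in ~` A & k in K] `&` closure A).

(* [R[i]] itself carries no topology in the library; [R[i]^o] is the same
   field with the topology of the complex modulus. *)
Definition dual_group : set (G -> R[i]) :=
  [set chi | [/\ continuous (chi : G -> R[i]^o),
                 forall x, cabs (chi x) = 1 &
                 forall x y, chi (x + y) = chi x * chi y]].

Definition trig_poly P : Prop :=
  exists n (c : 'I_n -> R[i]) (chi : 'I_n -> G -> R[i]),
    (forall j, dual_group (chi j)) /\
    P = (fun t => \sum_(j < n) c j * chi j t).

Definition cmeasurable f : Prop :=
  measurable_fun [set: borel G] (fun t : borel G => complex.Re (f t)) /\
  measurable_fun [set: borel G] (fun t : borel G => complex.Im (f t)).

Definition cbounded f : Prop := exists M : R, forall t, cabs (f t) <= M.

Definition parseval (a : (G -> R[i]) -> R[i]) (M : R) : Prop :=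
  (\esum_(chi in dual_group) (cabs (a chi) ^+ 2)%:E = M%:E)%E.

End topological_group.

Section haar.
Variables (R : realType) (G : topologicalZmodType).
Variable theta : {measure set (borel G) -> \bar R}.
Implicit Types (A B : (set G)^nat) (S V : set G) (f P chi : G -> R[i]).

Record haar_measure : Prop := HaarMeasure {
  haar_neq0 : theta [set: G] <> 0%E ;
  haar_compact : forall K : set G, compact K -> (theta K < +oo)%E ;
  haar_translate : forall (x : G) (E : set (borel G)),
    measurable E -> theta (translate x E) = theta E ;
  haar_outer_regular : forall E : set (borel G), measurable E ->
    theta E = ereal_inf [set theta U | U in [set U : set G |
                                              open U /\ E `<=` U]] ;
  haar_inner_regular : forall U : set G, open U ->
    theta U = ereal_sup [set theta K | K in [set K : set G |
                                              compact K /\ K `<=` U]]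
}.

(* Junk value 0 when [theta S] is infinite; only used on relatively compact
   sets. *)
Definition vol S : R := fine (theta S).

Record van_hove A : Prop := VanHove {
  van_hove_open : forall n, open (A n) ;
  van_hove_precompact : forall n, precompact (A n) ;
  van_hove_gt0 : forall n, (0 < theta (A n))%E ;
  van_hove_cvg : forall K : set G, compact K ->
    vol (van_hove_boundary K (A n)) / vol (A n) @[n --> \oo] --> (0 : R)
}.

(* The averages are |V|^-1 times an integral over S, since the integrals are
   taken over translates S of V. *)
Definition average V S (g : G -> R) : R :=
  (vol V)^-1 * \int[theta]_(t in S) g t.

Definition caverage V S f : R[i]^o :=
  average V S (fun t => complex.Re (f t)) +i* average V S (fun t => complex.Im (f t)).

Definition eaverage V S (g : G -> R) : \bar R :=
  ((vol V)^-1%:E * \int[theta]_(t in S) (g t)%:E)%E.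

Definition Lloc (p : nat) f : Prop :=
  cmeasurable f /\
  forall K : set G, compact K ->
    (\int[theta]_(t in K) (cabs (f t) ^+ p)%:E < +oo)%E.

Definition weyl_almost_periodic A f : Prop :=
  Lloc 1 f /\
  forall e : R, 0 < e -> exists2 P, trig_poly P &
    (limn_esup (fun n => ereal_sup
       [set eaverage (A n) (translate x (A n)) (fun t => cabs (f t - P t))%R
       | x in [set: G]]) < e%:E)%E.

Definition besicovitch2_almost_periodic B f : Prop :=
  Lloc 2 f /\
  forall e : R, 0 < e -> exists2 P, trig_poly P &
    (limn_esup (fun n =>
       sqrte (eaverage (B n) (B n) (fun t => cabs (f t - P t) ^+ 2)%R))
     < e%:E)%E.

(* Limits that are uniform over all translates of the averaging sets. For van
   Hove sequences and bounded functions the limit cannot depend on the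
   translate. *)
Definition uniform_mean A (g : G -> R) (M : R) : Prop :=
  {uniform, (fun n s => average (A n) (translate s (A n)) g) @ \oo
            --> (fun=> M : R)}.

Definition uniform_cmean A f (m : R[i]) : Prop :=
  {uniform, (fun n s => caverage (A n) (translate s (A n)) f) @ \oo
            --> (fun=> m : R[i]^o)}.

Definition uniform_parseval A f : Prop :=
  exists (a : (G -> R[i]) -> R[i]) (M : R),
    [/\ forall chi, dual_group chi ->
          uniform_cmean A (fun t => f t * conjc (chi t)) (a chi),
        uniform_mean A (fun t => cabs (f t) ^+ 2) M &
        parseval a M].

Definition mean_parseval B f : Prop :=
  exists (a : (G -> R[i]) -> R[i]) (M : R),
    [/\ forall chi, dual_group chi ->
          caverage (B n) (B n) (fun t => f t * conjc (chi t)) @[n --> \oo]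
            --> (a chi : R[i]^o),
        average (B n) (B n) (fun t => cabs (f t) ^+ 2) @[n --> \oo]
            --> (M : R) &
        parseval a M].

(* The existence of the uniform mean does not depend on the van Hove sequence;
   we ask for it along all of them. *)
Definition amenable f : Prop :=
  [/\ cmeasurable f, cbounded f &
      forall A, van_hove A -> exists m : R[i], uniform_cmean A f m].

End haar.

(* Main.v *)
Require Import Defs.
From mathcomp Require Import all_boot all_order all_algebra.
From mathcomp Require Import all_classical all_reals all_analysis.
From mathcomp Require Import complex.
From mathcomp Require Import measurable_realfun ring lra.

(** All averages are taken along a filter of sets that are asymptotically
    invariant under translation: the members of a van Hove sequence, or all their
    translates at once.

    For such a filter nontrivial characters have mean zero, so subtracting
    [c chi] from [f] changes only the coefficient at [chi], and changes
    [M(|f|^2)] by [|a_chi - c|^2 - |a_chi|^2].  This yields Bessel's inequality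
    and shows that Parseval's identity means that [f] is a limit of trigonometric
    polynomials in mean square.  For bounded [f] the approximation in mean and in
    mean square agree, because an approximating polynomial can be truncated to the
    bound of [f], the truncation being again a uniform limit of trigonometric
    polynomials.

    Uniform means do not depend on the van Hove sequence: integrate the averages
    over translates of [A n] against [B m] and exchange the integrals.  Fubini's
    theorem for product measures is not available, since addition need not be
    measurable for the product of the Borel sigma-algebras when [G] is not second
    countable; the exchange is proved directly from regularity.  Conversely, means
    that exist along all van Hove sequences are uniform along [A], since otherwise
    translates of members of [A] could be interleaved with [A] into a van Hove
    sequence without mean. *)

Set Implicit Arguments.
Unset Strict Implicit.
Unset Printing Implicit Defensive.

Import Order.TTheory GRing.Theory Num.Theory.
Import numFieldTopology.Exports numFieldNormedType.Exports.

Local Open Scope classical_set_scope.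
Local Open Scope ring_scope.

(** * Borel sets and translations *)

Section borel_sets.
Context {G : topologicalZmodType}.
Implicit Types (x y : G) (S K U : set G).

Definition borel_set S := measurable (S : set (borel G)).

Lemma open_borel_set U : open U -> borel_set U.
Proof. by move=> oU; apply: sub_sigma_algebra. Qed.

Lemma closed_borel_set K : closed K -> borel_set K.
Proof.
move=> cK; rewrite -(setCK K); apply: measurableC.
by apply: open_borel_set; exact: closed_openC.
Qed.

Lemma continuous_borel (R : realType) (h : G -> R) :
  continuous h -> measurable_fun [set: borel G] (h : borel G -> R).
Proof.
move=> /continuousP ch; apply:
  (measurability _ (measurable_realfun.RGenOpens.measurableE R)).
move=> _ [_ [a [b ->] <-]]; rewrite setTI; apply: open_borel_set; apply: ch.
exact: interval_open.
Qed.

Lemma continuous_borelG (h : G -> G) :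
  continuous h -> measurable_fun [set: borel G] (h : borel G -> borel G).
Proof.
move=> /continuousP ch; apply:
  (@measurability _ _ (borel G) (borel G) _ _ (@open G)) => //.
by move=> _ [U oU <-]; rewrite setTI; apply: open_borel_set; exact: ch.
Qed.

Lemma addl_continuous x : continuous (fun y => x + y).
Proof.
move=> y; apply: (@continuous_comp _ _ _ (fun y => (x, y)) (fun z : G * G => z.1 + z.2)).
  by apply: cvg_pair => /=; [exact: cvg_cst|exact: cvg_id].
exact: add_continuous.
Qed.

Arguments addl_continuous : clear implicits.

Lemma translateE x S : translate x S = (fun y => - x + y) @^-1` S.
Proof.
apply/seteqP; split => [_ [a Sa <-]|y Sy] /=; first by rewrite addrA addNr add0r.
by exists (- x + y) => //; rewrite addrA subrr add0r.
Qed.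

Lemma translateP x S y : translate x S y <-> S (y - x).
Proof. by rewrite translateE /= addrC. Qed.

Lemma translate0 S : translate 0 S = S.
Proof. by rewrite translateE; apply/seteqP; split => y /=; rewrite oppr0 add0r. Qed.

Lemma translateD x y S : translate x (translate y S) = translate (x + y) S.
Proof.
by rewrite !translateE; apply/seteqP; split => z /=;
  rewrite opprD (addrC (- x) (- y)) -addrA.
Qed.

Lemma translateI x S T : translate x (S `&` T) = translate x S `&` translate x T.
Proof. by rewrite !translateE. Qed.

Lemma translateDset x S T : translate x (S `\` T) = translate x S `\` translate x T.
Proof. by rewrite !translateE. Qed.

Lemma translateC x S : translate x (~` S) = ~` translate x S.
Proof. by rewrite !translateE. Qed.

Lemma subset_translate x S T : S `<=` T -> translate x S `<=` translate x T.
Proof. by move=> ST; rewrite !translateE => y /ST. Qed.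

Lemma open_translate x U : open U -> open (translate x U).
Proof. by rewrite translateE; move/continuousP: (addl_continuous (- x)); apply. Qed.

Lemma closed_translate x U : closed U -> closed (translate x U).
Proof.
by move=> cU; rewrite -(setCK U) translateC; apply: open_closedC; apply: open_translate;
  exact: closed_openC.
Qed.

Lemma compact_translate x K : compact K -> compact (translate x K).
Proof.
move=> cK; apply: (@continuous_compact _ _ (fun y => x + y)) => //.
by apply: continuous_subspaceT; exact: addl_continuous.
Qed.

Lemma borel_set_translate x S : borel_set S -> borel_set (translate x S).
Proof.
move=> mS; rewrite translateE.
have := continuous_borelG (addl_continuous (- x)) measurableT mS.
by rewrite setTI.
Qed.

Lemma closure_translate x S : closure (translate x S) = translate x (closure S).
Proof.
have sub y T : closure (translate y T) `<=` translate y (closure T).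
  rewrite closureE => z; apply; split; first by apply: closed_translate;
    exact: closed_closure.
  by apply: subset_translate; exact: subset_closure.
apply/seteqP; split; first exact: sub.
have /(@subset_translate x) := sub (- x) (translate x S).
by rewrite !translateD addNr subrr !translate0.
Qed.

Lemma precompact_translate x S : precompact S -> precompact (translate x S).
Proof. by rewrite !precompactE closure_translate; exact: compact_translate. Qed.

End borel_sets.

Arguments addl_continuous {G} x _.

(** * Integrals of bounded measurable functions *)

Section bounded_measurable.
Context {R : realType} {G : topologicalZmodType}.
Implicit Types (x y : G) (S T : set G) (g h : G -> R).

(** This class of integrands is closed under the operations used below and integrable on every set
    of finite volume, so linearity and monotonicity of the integral carry no further side
    conditions. *)
Definition bmeas g := measurable_fun [set: borel G] (g : borel G -> R) /\
  exists M : R, forall t, `|g t| <= M.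

Lemma bmeasD g h : bmeas g -> bmeas h -> bmeas (fun t => g t + h t).
Proof.
move=> [mg [M gM]] [mh [N hN]]; split; first exact: measurable_funD.
by exists (M + N) => t; apply: le_trans (ler_normD _ _) _; exact: lerD.
Qed.

Lemma bmeasM g h : bmeas g -> bmeas h -> bmeas (fun t => g t * h t).
Proof.
move=> [mg [M gM]] [mh [N hN]]; split; first exact: measurable_funM.
by exists (M * N) => t; rewrite normrM; apply: ler_pM.
Qed.

Lemma bmeas_cst (c : R) : bmeas (fun=> c).
Proof. by split => //; exists `|c|. Qed.

Lemma bmeasN g : bmeas g -> bmeas (fun t => - g t).
Proof.
move=> [mg [M gM]]; split; first exact: measurableT_comp.
by exists M => t; rewrite normrN.
Qed.

Lemma bmeasB g h : bmeas g -> bmeas h -> bmeas (fun t => g t - h t).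
Proof. by move=> bg bh; apply: bmeasD => //; exact: bmeasN. Qed.

Lemma bmeas_norm g : bmeas g -> bmeas (fun t => `|g t|).
Proof.
move=> [mg [M gM]]; split; first exact: measurableT_comp.
by exists M => t; rewrite normr_id.
Qed.

Lemma bmeasX g n : bmeas g -> bmeas (fun t => g t ^+ n).
Proof.
move=> [mg [M gM]]; split; first exact: measurable_funX.
by exists (M ^+ n) => t; rewrite normrX lerXn2r// nnegrE (le_trans _ (gM t)).
Qed.

Lemma bmeas_shift x g : bmeas g -> bmeas (fun t => g (x + t)).
Proof.
move=> [mg [M gM]]; split; last by exists M => t.
apply: (@measurableT_comp _ _ _ (borel G) (borel G) R g setT (fun t => x + t :
  borel G)) => //.
exact: (continuous_borelG (addl_continuous x)).
Qed.

Lemma bmeas_indic S : borel_set S -> bmeas (\1_S : G -> R).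
Proof.
move=> mS; split; first exact: (@measurable_indic _ (borel G)).
by exists 1 => t; rewrite indicE normr_nat lern1 leq_b1.
Qed.

Lemma bmeas_continuous g : continuous g -> (exists M : R, forall t, `|g t|
  <= M) -> bmeas g.
Proof. by move=> cg ?; split => //; exact: continuous_borel. Qed.

End bounded_measurable.

(** * Volumes and integrals over sets of finite Haar measure *)

Section haar_integral.
Context {R : realType} {G : topologicalZmodType}.
Context {theta : {measure set (borel G) -> \bar R}}.
Implicit Types (x y : G) (S T : set G) (g h : G -> R).

Local Notation J S g := (\int[theta]_(t in (S : set (borel G))) g t).
Local Notation vol := (vol theta).

Definition finite_vol S := borel_set S /\ (theta S < +oo)%E.

Lemma finite_volS S T : borel_set S -> S `<=` T -> finite_vol T -> finite_vol S.
Proof.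
move=> mS ST [mT T_lt]; split => //; apply: le_lt_trans T_lt.
by apply: le_measure => //; rewrite inE.
Qed.

Lemma finite_volI S T : finite_vol S -> borel_set T -> finite_vol (S `&` T).
Proof. by move=> fS mT; apply: (finite_volS _ _ fS); [apply: measurableI => //;
  exact: fS.1|exact: subIsetl]. Qed.

Lemma finite_volD S T : finite_vol S -> borel_set T -> finite_vol (S `\` T).
Proof. by move=> fS mT; apply: (finite_volS _ _ fS); [apply: measurableD => //;
  exact: fS.1|exact: subDsetl]. Qed.

Lemma volE S : finite_vol S -> (vol S)%:E = theta S.
Proof. by move=> [_ S_lt]; rewrite /Defs.vol fineK// ge0_fin_numE. Qed.

Lemma vol_ge0 S : 0 <= vol S.
Proof. exact: fine_ge0. Qed.

Lemma finite_volU S T : finite_vol S -> finite_vol T -> finite_vol (S `|` T).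
Proof.
move=> fS fT; split; first by apply: measurableU; [exact: fS.1|exact: fT.1].
apply: le_lt_trans (measureU2 _ _ _) _; [exact: fS.1|exact: fT.1|].
by apply: lte_add_pinfty; [exact: fS.2|exact: fT.2].
Qed.

Lemma le_vol S T : borel_set S -> finite_vol T -> S `<=` T -> vol S <= vol T.
Proof.
move=> mS fT ST; rewrite -lee_fin !volE//; last exact: finite_volS fT.
by apply: le_measure => //; rewrite inE//; exact: fT.1.
Qed.

Lemma volU S T : finite_vol S -> finite_vol T -> vol (S `|` T) <= vol S + vol T.
Proof.
move=> fS fT; rewrite -lee_fin EFinD !volE//; last exact: finite_volU.
by apply: measureU2; [exact: fS.1|exact: fT.1].
Qed.

Lemma volDI S T : finite_vol S -> borel_set T -> vol S = vol (S `\` T) + vol (S `&` T).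
Proof.
move=> fS mT; apply: EFin_inj; rewrite EFinD !volE//;
  [|exact: finite_volI|exact: finite_volD].
by apply: measureDI => //; exact: fS.1.
Qed.

Lemma bmeas_integrable S g : finite_vol S -> bmeas g -> theta.-integrable S (EFin \o g).
Proof.
move=> [mS S_lt] [mg [M gM]]; apply: measurable_bounded_integrable => //.
  exact: measurable_funTS.
by exists M; split; [exact: num_real|move=> N MN t _ /=; exact: le_trans (gM t) (ltW MN)].
Qed.

Lemma bRintegralD S g h : finite_vol S -> bmeas g -> bmeas h ->
  J S (fun t => g t + h t) = J S g + J S h.
Proof. by move=> fS bg bh; rewrite RintegralD//;
  [exact: fS.1|exact: bmeas_integrable..]. Qed.

Lemma bRintegralB S g h : finite_vol S -> bmeas g -> bmeas h ->
  J S (fun t => g t - h t) = J S g - J S h.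
Proof. by move=> fS bg bh; rewrite RintegralB//;
  [exact: fS.1|exact: bmeas_integrable..]. Qed.

Lemma bRintegralZ S c g : finite_vol S -> bmeas g -> J S (fun t => c * g t) = c * J S g.
Proof. by move=> fS bg; rewrite RintegralZl//;
  [exact: fS.1|exact: bmeas_integrable..]. Qed.

Lemma bRintegral_cst S c : finite_vol S -> J S (fun=> c) = c * vol S.
Proof. by move=> fS; rewrite Rintegral_cst//; exact: fS.1. Qed.

Lemma le_bRintegral S g h : finite_vol S -> bmeas g -> bmeas h -> (forall t, S t ->
  g t <= h t) ->
  J S g <= J S h.
Proof. by move=> fS bg bh gh; apply: le_Rintegral => //;
  [exact: fS.1|exact: bmeas_integrable..]. Qed.

Lemma le_norm_bRintegral S g : finite_vol S -> bmeas g -> `|J S g| <= J S (fun t => `|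
  g t|).
Proof. by move=> fS bg; apply: le_normr_Rintegral => //;
  [exact: fS.1|exact: bmeas_integrable..]. Qed.

Lemma norm_bRintegral_le S g M : finite_vol S -> bmeas g -> (forall t, S t -> `|g t|
  <= M) ->
  `|J S g| <= M * vol S.
Proof.
move=> fS bg gM; apply: le_trans (le_norm_bRintegral fS bg) _.
by rewrite -bRintegral_cst//; apply: le_bRintegral => //;
  [exact: bmeas_norm|exact: bmeas_cst].
Qed.

Lemma bRintegral_setDI S T g : finite_vol S -> borel_set T -> bmeas g ->
  J S g = J (S `\` T) g + J (S `&` T) g.
Proof.
move=> fS mT bg; have fST := finite_volD fS mT; have fSI := finite_volI fS mT.
rewrite -Rintegral_setU//; [|exact: fST.1|exact: fSI.1| |].
- by rewrite setDE -setIUr setUC setUv setIT.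
- by rewrite setDE -setIUr setUC setUv setIT; exact: bmeas_integrable.
- by apply/disj_setPS => t /= [[_ nTt] [_ /nTt]].
Qed.

Lemma bRintegral_near S T g M : finite_vol S -> finite_vol T -> bmeas g ->
  (forall t, `|g t| <= M) ->
  `|J S g - J T g| <= M * (vol (S `\` T) + vol (T `\` S)).
Proof.
move=> fS fT bg gM; rewrite (bRintegral_setDI fS fT.1 bg) (bRintegral_setDI fT fS.1
  bg) (setIC T).
rewrite opprD addrACA subrr addr0; apply: le_trans (ler_normB _ _) _.
rewrite mulrDr lerD//; apply: norm_bRintegral_le => //; apply: finite_volD => //;
  [exact: fT.1|exact: fS.1].
Qed.

Lemma bRintegral_indic S T : finite_vol S -> borel_set T -> J S (\1_T) = vol (T `&` S).
Proof.
move=> fS mT; rewrite /Rintegral/=; congr fine.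
by rewrite integral_indic//; exact: fS.1.
Qed.

Hypothesis haar_theta : haar_measure theta.

Lemma finite_vol_translate x S : finite_vol S -> finite_vol (translate x S).
Proof. by move=> [mS S_lt]; split;
  [exact: borel_set_translate|rewrite haar_translate]. Qed.

Lemma vol_translate x S : borel_set S -> vol (translate x S) = vol S.
Proof. by move=> mS; rewrite /Defs.vol haar_translate. Qed.

Lemma bRintegral_translate x S g : finite_vol S -> bmeas g ->
  J (translate x S) g = J S (fun t => g (x + t)).
Proof.
move=> fS bg; rewrite /Rintegral; congr fine.
pose p : borel G -> borel G := fun t => x + (t : G).
have mp : measurable_fun setT p := continuous_borelG (addl_continuous x).
(* By invariance the push-forward of [theta] under [p] is [theta] again; what remains is a change of
   variables. *)
transitivity (\int[pushforward theta p]_(t in (translate x S :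
  set (borel G))) (g t)%:E)%E.
  apply: eq_measure_integral => T mT _; rewrite /pushforward.
  rewrite -(haar_translate haar_theta (- x) mT); congr (theta _).
  by rewrite translateE opprK.
have mT : borel_set (translate x S) by apply: borel_set_translate; exact: fS.1.
have pS : p @^-1` (translate x S : set (borel G)) = S.
  by apply/seteqP; split => t /=; [move=> [s Ss /addrI <-]|move=> St; exists t].
rewrite integral_pushforward ?pS//; first by apply/measurable_EFinP; exact: bg.1.
by apply: bmeas_integrable => //; exact: bmeas_shift.
Qed.

End haar_integral.

(** * Regularity of Haar measure and continuity of translation *)

Section translation_continuity.
Context {R : realType} {G : topologicalZmodType}.
Context {theta : {measure set (borel G) -> \bar R}}.
Hypothesis hausdorffG : hausdorff_space G.
Hypothesis haar_theta : haar_measure theta.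
Implicit Types (x y : G) (S T D B E K : set G) (g h : G -> R).

Local Notation J S g := (\int[theta]_(t in (S : set (borel G))) g t).
Local Notation vol := (vol theta).
Local Notation finite_vol := (@finite_vol R G theta).

Lemma addG_cvg (T : Type) (F : set_system T) (p q : T -> G) (a b : G) : Filter F ->
  p @ F --> a -> q @ F --> b -> (fun t => p t + q t) @ F --> a + b.
Proof.
move=> FF pa qb; apply: (@continuous2_cvg _ _ _ _ F FF p q (fun x y => x + y) a b) => //.
exact: (add_continuous (a, b)).
Qed.

Lemma subG_cvg (T : Type) (F : set_system T) (p q : T -> G) (a b : G) : Filter F ->
  p @ F --> a -> q @ F --> b -> (fun t => p t - q t) @ F --> a - b.
Proof.
move=> FF pa qb; apply: (@continuous2_cvg _ _ _ _ F FF p q (fun x y => x - y) a b) => //.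
exact: (@tvs.sub_continuous G (a, b)).
Qed.

Lemma compact_finite_vol K : compact K -> finite_vol K.
Proof.
move=> cK; split; last exact: haar_compact.
by apply: closed_borel_set; exact: compact_closed.
Qed.

Lemma precompact_finite_vol S : borel_set S -> precompact S -> finite_vol S.
Proof.
rewrite precompactE => mS /compact_finite_vol; apply: finite_volS => //.
exact: subset_closure.
Qed.

Lemma outer_approx E (e : R) : finite_vol E -> 0 < e ->
  exists U, [/\ open U, E `<=` U, finite_vol U & vol (U `\` E) <= e].
Proof.
move=> fE e0; have := haar_outer_regular haar_theta fE.1.
set I := (X in ereal_inf X) => thetaE.
have I_fin : ereal_inf I \is a fin_num.
  by rewrite -thetaE ge0_fin_numE//; exact: fE.2.
have [_ [U [oU EU] <-]] := lb_ereal_inf_adherent e0 I_fin.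
rewrite -thetaE -(volE fE) -EFinD => Ult; have fU : finite_vol U.
  by split; [exact: open_borel_set|exact: lt_trans Ult (ltry _)].
exists U; split => //.
move: Ult; rewrite -(volE fU) lte_fin (volDI fU fE.1) (setIidr EU).
by rewrite addrC ltrD2l => /ltW.
Qed.

(** Inner regularity is assumed for open sets. A general set is therefore approximated in two steps:
    by an open superset, then by a compact subset of that superset. *)
Lemma inner_approx U (e : R) : open U -> finite_vol U -> 0 < e ->
  exists K, [/\ compact K, K `<=` U & vol (U `\` K) <= e].
Proof.
move=> oU fU e0; have := haar_inner_regular haar_theta oU.
set I := (X in ereal_sup X) => thetaE.
have I_fin : ereal_sup I \is a fin_num.
  by rewrite -thetaE ge0_fin_numE//; exact: fU.2.
have [_ [K [cK KU] <-]] := ub_ereal_sup_adherent e0 I_fin.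
have fK := compact_finite_vol cK.
rewrite -thetaE -(volE fU) -(volE fK) -EFinB lte_fin => Ult.
exists K; split => //; move: Ult; rewrite (volDI fU fK.1) (setIidr KU).
by rewrite ltrBlDr addrC ltrD2l => /ltW.
Qed.

(** A tube argument: [x - u + v] is continuous and equals [x] at [u = v = 0], and compactness of [K]
    makes the neighbourhoods uniform. The two perturbations will serve the two orders of
    integration. *)
Lemma near_sub_add_subset K U : compact K -> open U -> K `<=` U ->
  exists W : set G, [/\ open W, W 0 &
    forall k u v, K k -> W u -> W v -> U (k - u + v)].
Proof.
move=> cK oU KU.
have cov := (iffLR (compact_near_coveringP K)) cK.
have [|[P Q] [/= P0 Q0] PQ] := cov (G * G)%type (nbhs ((0 : G), (0 : G)))
    (fun uv x => U (x - uv.1 + uv.2)) _.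
  move=> x Kx.
  have c : (fun z : G * (G * G) => z.1 - z.2.1 + z.2.2) @ (x, ((0 : G), (0 : G))) --> x.
    rewrite -[X in _ --> X]addr0 -[X in _ --> X + _]subr0.
    apply: addG_cvg; last by apply: (cvg_comp _ _ (@cvg_snd _ _ _ _ _)); exact: cvg_snd.
    apply: subG_cvg; first exact: cvg_fst.
    by apply: (cvg_comp _ _ (@cvg_snd _ _ _ _ _)); exact: cvg_fst.
  exact: c (open_nbhs_nbhs (conj oU (KU _ Kx))).
exists (P^° `&` Q^°); split.
- by apply: openI; exact: open_interior.
- by split; rewrite /interior.
- move=> k u v Kk [/interior_subset Pu _] [_ /interior_subset Qv].
  by have := PQ (u, v) (conj Pu Qv) k Kk.
Qed.

Lemma near_translate_subset K U : compact K -> open U -> K `<=` U ->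
  \forall u \near (0 : G), translate u K `<=` U.
Proof.
move=> cK oU KU; have [W [oW W0 WU]] := near_sub_add_subset cK oU KU.
apply: filterS (open_nbhs_nbhs (conj oW W0)) => u Wu _ [x Kx <-].
by rewrite addrC -(subr0 x); exact: WU.
Qed.

Lemma near_vol_translateD E (e : R) : finite_vol E -> 0 < e ->
  \forall u \near (0 : G), vol (translate u E `\` E) <= e.
Proof.
move=> fE e0; have e20 : 0 < e / 2 by rewrite divr_gt0.
have [U [oU EU fU UE]] := outer_approx fE e20.
have [K [cK KU UK]] := inner_approx oU fU e20.
have mK := (compact_finite_vol cK).1.
apply: filterS (near_translate_subset cK oU KU) => u uKU.
have fUK : finite_vol (translate u (U `\` K)).
  by apply: (finite_vol_translate haar_theta); exact: finite_volD.
have fUE : finite_vol (U `\` E) by apply: finite_volD => //; exact: fE.1.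
(* A point of [u + E] outside [E] comes from [K], and then still lies in [U], or from the rest of
   [U]; both exceptional sets have volume at most [e / 2]. *)
have sub : translate u E `\` E `<=` translate u (U `\` K) `|` (U `\` E).
  move=> y [/translateP Ey nEy].
  have [Ky|nKy] := pselect (K (y - u)).
    by right; split => //; apply: uKU; apply/translateP.
  by left; apply/translateP; split => //; exact: EU.
apply: le_trans (le_vol _ (finite_volU fUK fUE) sub) _.
  by apply: measurableD; [apply: borel_set_translate|]; exact: fE.1.
apply: le_trans (volU fUK fUE) _.
rewrite (vol_translate haar_theta).
  by rewrite [leRHS]splitr lerD.
by apply: measurableD => //; exact: fU.1.
Qed.

(** Nearby translates of [D] have a symmetric difference of small volume. This continuity supplies
    the measurability of inner integrals when integrals are exchanged. *)
Lemma bRintegral_translate_continuous D g : finite_vol D -> bmeas g ->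
  continuous (fun t : G => J (translate t D) g : R).
Proof.
move=> fD bg t0; have [_ [M gM]] := bg.
have M0 : 0 <= M by exact: le_trans (gM 0).
apply/cvgrPdist_le => /= e e0.
(* Two one-sided differences of volume at most [d], weighted by [M + 1], add up to at most [e]; the
   summand 1 covers the case [M = 0]. *)
pose d := e / (2 * (M + 1)).
have d0 : 0 < d by rewrite divr_gt0// mulr_gt0// ltr_wpDl.
have nd := near_vol_translateD fD d0.
have n1 : \forall t \near t0, vol (translate (t - t0) D `\` D) <= d.
  have : (fun t => t - t0) @ t0 --> (0 : G).
    rewrite -[X in _ --> X](subrr t0).
    by apply: subG_cvg; [exact: cvg_id|exact: cvg_cst].
  by move=> /(_ _ nd).
have n2 : \forall t \near t0, vol (translate (t0 - t) D `\` D) <= d.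
  have : (fun t => t0 - t) @ t0 --> (0 : G).
    rewrite -[X in _ --> X](subrr t0).
    by apply: subG_cvg; [exact: cvg_cst|exact: cvg_id].
  by move=> /(_ _ nd).
have vT x y : vol (translate x D `\` translate y D) = vol (translate (x - y) D `\` D).
  rewrite -[RHS](vol_translate haar_theta y).
    by rewrite translateDset translateD addrC subrK.
  by apply: measurableD; [apply: borel_set_translate|]; exact: fD.1.
apply: filterS2 n1 n2 => t h1 h2.
apply: le_trans (bRintegral_near (finite_vol_translate haar_theta t0 fD)
  (finite_vol_translate haar_theta t fD) bg gM) _.
rewrite !vT; apply: (@le_trans _ _ ((M + 1) * (d + d))).
  by apply: ler_pM => //; [rewrite addr_ge0// vol_ge0|rewrite lerDl|exact: lerD].
have M1 : M + 1 != 0 by rewrite lt0r_neq0// ltr_wpDl.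
by rewrite le_eqVlt; apply/orP; left; apply/eqP; rewrite /d; field.
Qed.

Lemma bmeas_bRintegral_translate D g : finite_vol D -> bmeas g ->
  bmeas (fun t : G => J (translate t D) g : R).
Proof.
move=> fD bg; apply: bmeas_continuous; first exact: bRintegral_translate_continuous.
have [_ [M gM]] := bg; exists (M * vol D) => t.
rewrite -(vol_translate haar_theta t fD.1); apply: norm_bRintegral_le => //.
exact: finite_vol_translate.
Qed.

End translation_continuity.

(** * Exchanging the order of integration *)

Section exchange.
Context {R : realType} {G : topologicalZmodType}.
Context {theta : {measure set (borel G) -> \bar R}}.
Hypothesis hausdorffG : hausdorff_space G.
Hypothesis haar_theta : haar_measure theta.
Implicit Types (x y : G) (S T D B E K W : set G) (g h : G -> R).

Local Notation J S g := (\int[theta]_(t in (S : set (borel G))) g t).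
Local Notation vol := (vol theta).
Local Notation finite_vol := (@finite_vol R G theta).
(** The iterated integral of [g (s + t)] over [s] in [D] and [t] in [B], with [s] outermost.
    Exchanging the integrals amounts to symmetry in [D] and [B]. *)
Definition itint D B g : R := J D (fun s => J (translate s B) g).

Let bJ := bmeas_bRintegral_translate hausdorffG haar_theta.
Let fT := finite_vol_translate haar_theta.

Lemma bRintegral_translate_indic B E s : finite_vol B -> borel_set E ->
  J (translate s B) (\1_E) = vol (E `&` translate s B).
Proof. by move=> fB mE; apply: bRintegral_indic => //; exact: fT. Qed.

Lemma itint_near D B g h (e : R) : finite_vol D -> finite_vol B -> bmeas g -> bmeas h ->
  (forall s, `|J (translate s B) g - J (translate s B) h| <= e) ->
  `|itint D B g - itint D B h| <= e * vol D.
Proof.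
move=> fD fB bg bh H; rewrite /itint -bRintegralB//; [|exact: bJ..].
by apply: norm_bRintegral_le => //; apply: bmeasB; exact: bJ.
Qed.

Lemma itint_cst D B c : finite_vol D -> finite_vol B ->
  itint D B (fun=> c) = c * vol B * vol D.
Proof.
move=> fD fB; rewrite /itint -bRintegral_cst//; apply: eq_Rintegral => s _.
by rewrite bRintegral_cst ?(vol_translate haar_theta _ fB.1)//; exact: fT.
Qed.

Lemma itint_D D B g h : finite_vol D -> finite_vol B -> bmeas g -> bmeas h ->
  itint D B (fun t => g t + h t) = itint D B g + itint D B h.
Proof.
move=> fD fB bg bh; rewrite /itint -bRintegralD//; [|exact: bJ..].
by apply: eq_Rintegral => s _; rewrite bRintegralD//; exact: fT.
Qed.

Lemma itint_Z D B c g : finite_vol D -> finite_vol B -> bmeas g ->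
  itint D B (fun t => c * g t) = c * itint D B g.
Proof.
move=> fD fB bg; rewrite /itint -bRintegralZ//; last exact: bJ.
by apply: eq_Rintegral => s _; rewrite bRintegralZ//; exact: fT.
Qed.

Lemma itint_splitr B D T g : finite_vol D -> finite_vol B -> borel_set T -> bmeas g ->
  itint B D g = itint B (D `\` T) g + itint B (D `&` T) g.
Proof.
move=> fD fB mT bg; have fDT := finite_volD fD mT; have fIT := finite_volI fD mT.
rewrite /itint -bRintegralD//; [|exact: bJ..].
apply: eq_Rintegral => s _; rewrite translateDset translateI;
  apply: bRintegral_setDI => //.
  exact: fT.
exact: borel_set_translate.
Qed.

Lemma itint_splitl B D T g : finite_vol D -> finite_vol B -> borel_set T -> bmeas g ->
  itint D B g = itint (D `\` T) B g + itint (D `&` T) B g.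
Proof. by move=> fD fB mT bg; apply: bRintegral_setDI => //; exact: bJ. Qed.

(** Both sides are compared with [vol D] times the volume of the part of [K - W] in [s0 + B]: as [D]
    lies in [s0 + W], a translate [t + D] can meet [K] only if [s0 + t] lies in [K - W]. *)
Lemma itint_sandwich_small K E W s0 D B : open W ->
  (forall k u v, K k -> W u -> W v -> E (k - u + v)) ->
  borel_set K -> borel_set E -> finite_vol D -> finite_vol B -> D `<=` translate s0 W ->
  itint B D (\1_K) <= itint D B (\1_E).
Proof.
move=> oW KWE mK mE fD fB DW.
(* This is [K - W], written as a union of open sets so that it is Borel. *)
pose E' := \bigcup_(k in K) [set e | W (k - e)].
have mE' : borel_set E'.
  apply: open_borel_set; apply: bigcup_open => k _.
  have : continuous (fun e : G => k - e).
    by move=> e; apply: subG_cvg; [exact: cvg_cst|exact: cvg_id].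
  by move=> /continuousP; apply.
have bE' x : bmeas (fun t => \1_E' (x + t) : R).
  by apply: bmeas_shift; exact: bmeas_indic.
have bX F C : borel_set F -> finite_vol C -> bmeas (fun s => J (translate s C) (\1_F)).
  by move=> mF fC; apply: bJ => //; exact: bmeas_indic.
have c0 : 0 <= vol D := vol_ge0 _.
rewrite /itint.
apply: (@le_trans _ _ (J B (fun t => vol D * \1_E' (s0 + t)))).
  apply: le_bRintegral => //; [exact: bX|by apply: bmeasM => //; exact: bmeas_cst|].
  move=> t Bt; rewrite bRintegral_translate_indic//.
  have [->|/set0P[y [Ky /translateP Dy]]] := eqVneq (K `&` translate t D) set0.
    by rewrite /Defs.vol measure0 mulr_ge0.
  rewrite indicE mem_set.
    rewrite mulr1 -(vol_translate haar_theta t fD.1); apply: le_vol => //; last exact: fT.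
    by apply: measurableI => //; apply: borel_set_translate; exact: fD.1.
  exists y => //=; have /translateP := DW _ Dy.
  by rewrite opprD addrA addrAC.
rewrite bRintegralZ// -bRintegral_translate//; last exact: bmeas_indic.
rewrite bRintegral_translate_indic// mulrC -bRintegral_cst//.
apply: le_bRintegral => //; [exact: bmeas_cst|exact: bX|].
move=> s Ds; rewrite bRintegral_translate_indic//.
rewrite -(vol_translate haar_theta (s - s0)); last first.
  by apply: measurableI => //; apply: borel_set_translate; exact: fB.1.
apply: le_vol; first by apply: borel_set_translate; apply: measurableI => //;
  apply: borel_set_translate; exact: fB.1.
  by rewrite setIC; apply: finite_volI => //; exact: fT.
(* With [v = s - s0] and [u = k - (e - v)], both in [W], one has [e = k - u + v], which [KWE] puts
   into [E]. *)
rewrite translateI translateD subrK; apply: setSI => e /translateP[k Kk /= Wk].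
have /translateP Ws := DW _ Ds.
have := KWE _ _ _ Kk Wk Ws.
by rewrite subKr subrK.
Qed.

(** Induction on the cover: the part of [D] in the first translate of [W] is handled by the previous
    lemma, and both orders of integration are additive in [D]. *)
Lemma itint_sandwich_cover (l : seq G) K E W D B : open W ->
  (forall k u v, K k -> W u -> W v -> E (k - u + v)) ->
  borel_set K -> borel_set E -> finite_vol D -> finite_vol B ->
  D `<=` [set t | exists2 s, s \in l & translate s W t] ->
  itint B D (\1_K) <= itint D B (\1_E).
Proof.
move=> oW KWE mK mE + fB; elim: l D => [|s l IH] D fD DW.
  have -> : D = set0 by rewrite -subset0 => t /DW [].
  rewrite /itint Rintegral_set0 le_eqVlt; apply/orP; left; apply/eqP.
  rewrite -[RHS](mul0r (vol B)) -bRintegral_cst//; apply: eq_Rintegral => t _.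
  have -> : translate t set0 = set0 by rewrite translateE.
  by rewrite Rintegral_set0.
have mW : borel_set (translate s W) by apply: open_borel_set; exact: open_translate.
have bK := @bmeas_indic R _ _ mK; have bE := @bmeas_indic R _ _ mE.
rewrite (itint_splitr fD fB mW bK) (itint_splitl fD fB mW bE); apply: lerD.
  apply: IH; first exact: finite_volD.
  move=> t [Dt nWt]; have [s' + Wt] := DW _ Dt.
  by rewrite inE => /predU1P[ss'|sl]; [move: Wt; rewrite ss'|exists s'].
have fDW := finite_volI fD mW.
by apply: (itint_sandwich_small oW KWE mK mE fDW fB); exact: subIsetr.
Qed.

Lemma compact_cover_translate K W : compact K -> open W -> W 0 ->
  exists l : seq G, K `<=` [set t | exists2 s, s \in l & translate s W t].
Proof.
move=> cK oW W0.
(* Along this filter every given centre eventually belongs to the list, so near-covering compactness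
   yields a finite subcover. *)
pose F : set_system (seq G) := [set P : set (seq G) |
  exists l0 : seq G, forall l : seq G, {subset l0 <= l} -> P l].
have FF : Filter F.
  split; first by exists [::].
    move=> P Q [l0 H0] [l1 H1]; exists (l0 ++ l1) => l sub; split.
      by apply: H0 => s sl; apply: sub; rewrite mem_cat sl.
    by apply: H1 => s sl; apply: sub; rewrite mem_cat sl orbT.
  by move=> P Q PQ [l0 H0]; exists l0 => l /H0 /PQ.
have cov := (iffLR (compact_near_coveringP K)) cK.
have [x Kx|l0 H0] := cov (seq G) F (fun l t => exists2 s, s \in l & translate s W t) FF.
  exists (translate x W, [set l : seq G | x \in l]) => /=.
    split; last by exists [:: x] => l; apply; rewrite inE.
    apply: open_nbhs_nbhs; split; first exact: open_translate.
    by apply/translateP; rewrite subrr.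
  by move=> [t l] /= [Wt xl]; exists x.
by exists l0; exact: H0.
Qed.

Lemma itint_sandwich K E D B : compact K -> open E -> K `<=` E ->
  borel_set D -> precompact D -> finite_vol B ->
  itint B D (\1_K) <= itint D B (\1_E).
Proof.
move=> cK oE KE mD pD fB; have [W [oW W0 KWE]] := near_sub_add_subset cK oE KE.
have fD := precompact_finite_vol hausdorffG haar_theta mD pD.
have [l Dl] : exists l : seq G, closure D `<=` [set t |
  exists2 s, s \in l & translate s W t].
  by apply: compact_cover_translate => //; rewrite -precompactE.
apply: (itint_sandwich_cover oW KWE) => //.
- exact: (compact_finite_vol hausdorffG haar_theta cK).1.
- exact: open_borel_set.
- exact: subset_trans (@subset_closure _ D) Dl.
Qed.

Lemma vol_setI_le E O (e : R) S : finite_vol O -> borel_set E -> finite_vol S ->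
  E `<=` O ->
  vol (O `\` E) <= e -> vol (E `&` S) <= vol (O `&` S) <= vol (E `&` S) + e.
Proof.
move=> fO mE fS EO OE; have fE := finite_volS mE EO fO.
rewrite le_vol//=; [|by apply: measurableI => //;
  exact: fS.1|by apply: finite_volI => //; exact: fS.1|exact: setSI].
have fOS := finite_volI fO fS.1; have fES := finite_volI fE fS.1;
  have fD := finite_volD fO mE.
apply: le_trans (_ : vol (E `&` S `|` (O `\` E)) <= _).
  apply: le_vol => //; [exact: fOS.1|exact: finite_volU|].
  by move=> t [Ot St]; have [Et|nEt] := pselect (E t); [left|right].
by apply: le_trans (volU fES fD) _; rewrite lerD2l.
Qed.

Lemma le_addMr (a b c : R) : 0 <= c -> (forall e : R, 0 < e -> a <= b + e * c) -> a <= b.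
Proof.
move=> c0 H; apply/ler_addgt0Pr => e e0.
apply: le_trans (H (e / (c + 1)) _) _; first by rewrite divr_gt0// ltr_wpDl.
rewrite lerD2l mulrAC ler_pdivrMr ?ltr_wpDl// ler_wpM2l ?(ltW e0)//.
by rewrite lerDl.
Qed.

(** Open sets shrinking to [K] in volume turn the sandwich into an inequality with [K] on both
    sides. For precompact Borel [D] and [B] their roles can be swapped, so equality follows. *)
Lemma itint_compact_le K D B : compact K -> borel_set D -> precompact D -> finite_vol B ->
  itint B D (\1_K) <= itint D B (\1_K).
Proof.
move=> cK mD pD fB; have fK := compact_finite_vol hausdorffG haar_theta cK.
have fD := precompact_finite_vol hausdorffG haar_theta mD pD.
apply: (@le_addMr _ _ (vol D)); first exact: vol_ge0.
move=> e e0; have [U [oU KU fU UK]] := outer_approx haar_theta fK e0.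
apply: le_trans (itint_sandwich cK oU KU mD pD fB) _.
have bK := @bmeas_indic R _ _ fK.1; have bU := @bmeas_indic R _ _ fU.1.
rewrite -lerBlDl; apply: le_trans (ler_norm _) _; apply: itint_near => // s.
have fs := fT s fB.
rewrite !bRintegral_translate_indic//; [|exact: fK.1|exact: fU.1].
have /andP[h1 h2] := vol_setI_le fU fK.1 fs KU UK.
by rewrite ger0_norm ?subr_ge0// lerBlDl.
Qed.

Lemma exchange_compact K D B : compact K -> borel_set D -> precompact D ->
  borel_set B -> precompact B -> itint B D (\1_K) = itint D B (\1_K).
Proof.
move=> cK mD pD mB pB; apply: le_anti.
by rewrite !itint_compact_le//; exact: precompact_finite_vol.
Qed.

(** [E] and a compact [K] both lie in an open [U] and miss volume at most [e] of it, so the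
    integrals of their indicators differ by at most [e] over every translate. *)
Lemma exchange_finite_vol E D B : finite_vol E -> borel_set D -> precompact D ->
  borel_set B -> precompact B -> itint B D (\1_E) = itint D B (\1_E).
Proof.
move=> fE mD pD mB pB; apply/eqP; rewrite -subr_eq0 -normr_le0.
have fD := precompact_finite_vol hausdorffG haar_theta mD pD.
have fB := precompact_finite_vol hausdorffG haar_theta mB pB.
have c0 : 0 <= vol B + vol D by apply: addr_ge0; exact: vol_ge0.
apply: (le_addMr c0) => e e0; rewrite add0r.
have [U [oU EU fU UE]] := outer_approx haar_theta fE e0.
have [K [cK KU UK]] := inner_approx hausdorffG haar_theta oU fU e0.
have fK := compact_finite_vol hausdorffG haar_theta cK.
have bE := @bmeas_indic R _ _ fE.1; have bK := @bmeas_indic R _ _ fK.1.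
have H C s : finite_vol C -> `|J (translate s C) (\1_E) - J (translate s C) (\1_K)| <= e.
  move=> fC; have fs := fT s fC.
  rewrite !bRintegral_translate_indic//; [|exact: fK.1|exact: fE.1].
  have /andP[h1 h2] := vol_setI_le fU fK.1 fs KU UK.
  have /andP[h3 h4] := vol_setI_le fU fE.1 fs EU UE.
  by rewrite ler_norml; apply/andP; split; lra.
have h1 := itint_near fB fD bE bK (fun s => H D s fD).
have h2 := itint_near fD fB bE bK (fun s => H B s fB).
rewrite (exchange_compact cK mD pD mB pB) in h1.
rewrite mulrDr; apply: le_trans (ler_distD (itint D B (\1_K)) _ _) _.
by apply: lerD; [exact: h1|rewrite distrC; exact: h2].
Qed.

Lemma exchange_indic E D B : borel_set E -> borel_set D -> precompact D ->
  borel_set B -> precompact B -> itint B D (\1_E) = itint D B (\1_E).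
Proof.
move=> mE mD pD mB pB.
(* All sums of a point of [D] and a point of [B] lie in the compact set [L] below, so only the part
   of [E] in [L] contributes, and that part has finite volume. *)
have fD := precompact_finite_vol hausdorffG haar_theta mD pD.
have fB := precompact_finite_vol hausdorffG haar_theta mB pB.
pose L : set G := (fun z : G * G => z.1 + z.2) @` (closure D `*` closure B).
have cL : compact L.
  apply: continuous_compact; first by apply: continuous_subspaceT; exact: add_continuous.
  by rewrite !precompactE in pD pB; exact: compact_setX.
have fL := compact_finite_vol hausdorffG haar_theta cL.
have fEL : finite_vol (E `&` L) by rewrite setIC; apply: finite_volI.
have red F C : finite_vol F -> finite_vol C -> (forall s t, F s -> C t -> L (s + t)) ->
    itint F C (\1_E) = itint F C (\1_(E `&` L)).
  move=> fF fC FC; rewrite /itint; apply: eq_Rintegral => s /set_mem Fs.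
  rewrite !bRintegral_translate_indic//; last exact: fEL.1.
  congr Defs.vol; rewrite -setIA; congr setI.
  apply/esym/setIidr => t /translateP Ct.
  by rewrite -(subrK s t) addrC; exact: FC.
rewrite (red B D fB fD); last first.
  by move=> s t Bs Dt; rewrite addrC; exists (t, s) => //; split; exact: subset_closure.
rewrite [RHS](red D B fD fB); last first.
  by move=> s t Bs Dt; exists (s, t) => //; split; exact: subset_closure.
exact: exchange_finite_vol.
Qed.

(* Halving: subtracting (C/2) times the indicator of {g > C/2} halves the range of g. *)
Lemma exchange_pos n (C : R) g D B : borel_set D -> precompact D ->
  borel_set B -> precompact B -> measurable_fun [set: borel G] (g : borel G -> R) ->
  (forall t, 0 <= g t <= C) ->
  `|itint B D g - itint D B g| <= C / 2 ^+ n * (2 * (vol D * vol B)).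
Proof.
move=> mD pD mB pB; have fD := precompact_finite_vol hausdorffG haar_theta mD pD.
have fB := precompact_finite_vol hausdorffG haar_theta mB pB.
elim: n C g => [|n IH] C g mg gC.
  have C0 : 0 <= C by have /andP[] := gC 0; exact: le_trans.
  have bg : bmeas g by split => //; exists C => t; have /andP[g0 ?] := gC t;
    rewrite ger0_norm.
  have H E F : finite_vol E -> finite_vol F -> `|itint E F g| <= C * vol F * vol E.
    move=> fE fF; apply: norm_bRintegral_le => //; first exact: bJ.
    move=> s _; rewrite -(vol_translate haar_theta s fF.1);
      apply: norm_bRintegral_le => //.
      exact: fT.
    by move=> t _; have /andP[g0 ?] := gC t; rewrite ger0_norm.
  apply: le_trans (ler_normB _ _) _; apply: le_trans (lerD (H B D fB fD) (H D B fD fB)) _.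
  by rewrite le_eqVlt; apply/orP; left; apply/eqP; rewrite expr0 divr1; ring.
pose E := [set t | C / 2 < g t].
have mE : borel_set E.
  have -> : E = (g @^-1` `]C / 2, +oo[) by apply/seteqP; split => t;
    rewrite /E /= in_itv/= andbT.
  by rewrite -[_ @^-1` _]setTI; exact: mg.
pose g' t := g t - C / 2 * \1_E t.
have bE := @bmeas_indic R _ _ mE.
have bcE : bmeas (fun t => C / 2 * \1_E t) by apply: bmeasM => //; exact: bmeas_cst.
have mg' : measurable_fun [set: borel G] (g' : borel G -> R).
  by apply: measurable_funB => //; exact: bcE.1.
have g'C t : 0 <= g' t <= C / 2.
  have /andP[g0 gC'] := gC t; rewrite /g' indicE.
  have [Et|nEt] := boolP (t \in E); rewrite ?mulr1 ?mulr0 ?subr0.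
    by move: Et; rewrite inE /E/= => ?; apply/andP; split; lra.
  by rewrite g0/= leNgt; apply: contra nEt => ?; rewrite inE.
have bg' : bmeas g' by split => //; exists (C / 2) => t; have /andP[g0 ?] := g'C t;
  rewrite ger0_norm.
have -> : g = (fun t => g' t + C / 2 * \1_E t) by apply/funext => t; rewrite /g' subrK.
rewrite (itint_D fB fD bg' bcE) (itint_D fD fB bg' bcE).
rewrite (itint_Z (C / 2) fB fD bE) (itint_Z (C / 2) fD fB bE).
rewrite (exchange_indic mE mD pD mB pB) opprD addrACA subrr addr0.
have -> : C / 2 ^+ n.+1 = C / 2 / 2 ^+ n by rewrite exprS invfM mulrA.
exact: IH.
Qed.

Lemma exchange g D B : bmeas g -> borel_set D -> precompact D ->
  borel_set B -> precompact B -> itint B D g = itint D B g.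
Proof.
move=> bg mD pD mB pB; have fD := precompact_finite_vol hausdorffG haar_theta mD pD.
have fB := precompact_finite_vol hausdorffG haar_theta mB pB.
have [mg [M gM]] := bg; have bM := @bmeas_cst R G M.
(* The halving argument needs a nonnegative integrand. Adding [M] puts the values in [[0, 2 * M]],
   and constants integrate equally in both orders. *)
pose h t := M + g t.
have bh : bmeas h by apply: bmeasD.
have hM t : 0 <= h t <= 2 * M.
  by have := gM t; rewrite ler_norml /h => /andP[? ?]; apply/andP; split; lra.
have hE : itint B D h = itint D B h.
  apply/eqP; rewrite -subr_eq0 -normr_le0.
  pose v := 2 * M * (2 * (vol D * vol B)).
  have : (geometric v 2^-1 @ \oo --> (0 : R)).
    by apply: cvg_geometric; rewrite ger0_norm ?invr_ge0// invf_lt1 ?ltr1n.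
  move=> /cvgr_to_ge; apply; near=> n.
  apply: le_trans (exchange_pos n mD pD mB pB bh.1 hM) _.
  by rewrite /geometric /= exprVn /v mulrAC.
move: hE; rewrite (itint_D fB fD bM bg) (itint_D fD fB bM bg).
by rewrite (itint_cst M fB fD) (itint_cst M fD fB) mulrAC => /addrI.
Unshelve. all: by end_near. Qed.

End exchange.

(** * Averages over van Hove sequences *)

Section van_hove_means.
Context {R : realType} {G : topologicalZmodType}.
Context {theta : {measure set (borel G) -> \bar R}}.
Hypothesis hausdorffG : hausdorff_space G.
Hypothesis haar_theta : haar_measure theta.
Implicit Types (x y u : G) (S T D B E K W X : set G) (g h : G -> R) (A : (set G)^nat).

Local Notation J S g := (\int[theta]_(t in (S : set (borel G))) g t).
Local Notation vol := (vol theta).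
Local Notation finite_vol := (@finite_vol R G theta).
Local Notation itint := (@itint R G theta).

Lemma finite_vol_van_hove A n : van_hove theta A -> finite_vol (A n).
Proof.
move=> vA; apply: precompact_finite_vol => //; last exact: (van_hove_precompact vA n).
by apply: open_borel_set; exact: (van_hove_open vA n).
Qed.

Lemma vol_van_hove_gt0 A n : van_hove theta A -> 0 < vol (A n).
Proof.
move=> vA; rewrite -lte_fin (volE (finite_vol_van_hove n vA)).
exact: van_hove_gt0.
Qed.

(** The boundary is covered by the compact sets [closure D + K] and [closure D]; the first is closed
    since [G] is Hausdorff, so it contains the closure of [D + K]. *)
Lemma finite_vol_van_hove_boundary K D : compact K -> precompact D ->
  finite_vol (van_hove_boundary K D).
Proof.
rewrite precompactE => cK cD.
pose L : set G := (fun z : G * G => z.1 + z.2) @` (closure D `*` K).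
have cL : compact L.
  apply: continuous_compact; first by apply: continuous_subspaceT; exact: add_continuous.
  exact: compact_setX.
have fLD := finite_volU (compact_finite_vol hausdorffG haar_theta cL)
  (compact_finite_vol hausdorffG haar_theta cD).
apply: finite_volS _ _ fLD.
  by apply: closed_borel_set; apply: closedU; apply: closedI; exact: closed_closure.
apply: setUSS; last exact: subIsetr.
apply: subset_trans (@subIsetl _ _ _) _.
rewrite closureE; apply: smallest_sub; first exact: compact_closed.
by move=> _ [a Da [k Kk <-]]; exists (a, k) => //; split => //=; exact: subset_closure.
Qed.

Lemma translateD_sub_boundary K D u : K u ->
  translate u D `\` D `<=` van_hove_boundary K D.
Proof.
move=> Ku y [[a Da <-] nD]; left; split; last exact: subset_closure.
by apply: subset_closure; exists a => //; exists u => //; rewrite addrC.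
Qed.

Lemma vol_translateDC D u : finite_vol D ->
  vol (D `\` translate u D) = vol (translate u D `\` D).
Proof.
move=> fD; have fuD := finite_vol_translate haar_theta u fD.
have := vol_translate haar_theta u fD.1.
rewrite (volDI fuD fD.1) (volDI fD fuD.1) (setIC D).
by move=> /addIr.
Qed.

Lemma bRintegral_translate_near D g M x u : finite_vol D -> bmeas g -> (forall t, `|
  g t| <= M) ->
  `|J (translate u (translate x D)) g - J (translate x D) g|
    <= M * (2 * vol (translate u D `\` D)).
Proof.
move=> fD bg gM; have fxD := finite_vol_translate haar_theta x fD.
apply: le_trans (bRintegral_near (finite_vol_translate haar_theta u fxD) fxD bg gM) _.
rewrite (vol_translateDC _ fxD) translateD (addrC u) -translateD -translateDset.
rewrite (vol_translate haar_theta); first by rewrite mulr_natl mulr2n.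
by apply: measurableD; [apply: borel_set_translate|]; exact: fD.1.
Qed.

(** The iterated integral of [g] over [x + B] and [D] is evaluated in both orders. With [D] inside,
    the hypothesis on translates of [D] applies; with [D] outside, shifting [x + B] by elements of
    [D] changes its integral by a boundary term at most. *)
Lemma transfer_mean D B g (C M e : R) : borel_set D -> precompact D -> 0 < vol D ->
  borel_set B -> precompact B -> bmeas g -> (forall t, `|g t| <= C) ->
  (forall y, `|J (translate y D) g - vol D * M| <= vol D * e) ->
  forall x, `|J (translate x B) g - vol B * M|
    <= vol B * e + C * (2 * vol (van_hove_boundary (closure D) B)).
Proof.
move=> mD pD D0 mB pB bg gC De x; pose B' := translate x B.
have fD := precompact_finite_vol hausdorffG haar_theta mD pD.
have fB := precompact_finite_vol hausdorffG haar_theta mB pB.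
have mB' : borel_set B' := borel_set_translate x mB;
  have pB' : precompact B' := precompact_translate x pB.
have fB' : finite_vol B' := finite_vol_translate haar_theta x fB.
have vB' : vol B' = vol B := vol_translate haar_theta x mB.
have bJ E : finite_vol E -> bmeas (fun s => J (translate s E) g).
  by move=> fE; exact: bmeas_bRintegral_translate.
have fbd : finite_vol (van_hove_boundary (closure D) B).
  by apply: finite_vol_van_hove_boundary => //; rewrite -precompactE.
have C0 : 0 <= C := le_trans (normr_ge0 _) (gC 0).
have h1 : `|itint B' D g - vol D * M * vol B| <= vol D * e * vol B.
  rewrite /itint -vB' -bRintegral_cst// -bRintegralB//; [|exact: bJ|exact: bmeas_cst].
  apply: norm_bRintegral_le => //; apply: bmeasB; [exact: bJ|exact: bmeas_cst].
set bd := vol (van_hove_boundary _ _).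
have h2 : `|itint D B' g - J B' g * vol D| <= C * (2 * bd) * vol D.
  rewrite /itint -(bRintegral_cst (J B' g) fD) -bRintegralB//;
    [|exact: bJ|exact: bmeas_cst].
  apply: norm_bRintegral_le => //; first by apply: bmeasB; [exact: bJ|exact: bmeas_cst].
  move=> s Ds; apply: le_trans (bRintegral_translate_near x s fB bg gC) _.
  rewrite ler_wpM2l// ler_wpM2l//; apply: le_vol => //.
    by apply: measurableD => //; exact: borel_set_translate.
  by apply: translateD_sub_boundary; exact: subset_closure.
rewrite -(exchange hausdorffG haar_theta bg mD pD mB' pB') in h2.
rewrite -(ler_pM2r D0) -{1}(ger0_norm (ltW D0)) -normrM.
have -> : (J B' g - vol B * M) * vol D =
   (itint B' D g - vol D * M * vol B) - (itint B' D g - J B' g * vol D) by ring.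
apply: le_trans (ler_normB _ _) _; apply: le_trans (lerD h1 h2) _.
by rewrite le_eqVlt; apply/orP; left; apply/eqP; ring.
Qed.

(* [X = setT] gives limits uniform over all translates, [X = [set 0]] plain limits. *)
Definition translates_filter X : set_system (nat * G) :=
  [set P | \forall n \near \oo, forall x, X x -> P (n, x)].

Definition tavg A g (i : nat * G) : R :=
  average theta (A i.1) (translate i.2 (A i.1)) g.

Lemma tavgE A g n x : van_hove theta A ->
  vol (A n) * tavg A g (n, x) = J (translate x (A n)) g.
Proof.
by move=> /(vol_van_hove_gt0 n) An; rewrite /tavg /average mulVKf// lt0r_neq0.
Qed.

#[global] Instance translates_filter_filter X : Filter (translates_filter X).
Proof.
split.
- exact: nearW.
- by move=> P Q; rewrite /translates_filter /= => HP HQ;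
  apply: filterS2 HP HQ => n Pn Qn y Xy; split; [exact: Pn|exact: Qn].
- by move=> P Q PQ; rewrite /translates_filter /=; apply: filterS => n Pn y Xy;
  apply: PQ; exact: Pn.
Qed.

Lemma translates_filter_proper X x : X x -> ProperFilter (translates_filter X).
Proof.
move=> Xx; split; last exact: translates_filter_filter.
by move=> H; have [n Hn] := @filter_ex _ \oo _ _ H; exact: Hn Xx.
Qed.

#[global] Instance translates_filter_setT : ProperFilter (translates_filter setT).
Proof. exact: (@translates_filter_proper _ 0). Qed.

#[global] Instance translates_filter_set0 : ProperFilter (translates_filter [set 0]).
Proof. exact: (@translates_filter_proper _ 0). Qed.

Lemma translates_filterS X Y : X `<=` Y -> translates_filter Y `<=` translates_filter X.
Proof. by move=> XY P; rewrite /translates_filter /=; apply: filterS => n Pn x /XY;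
  exact: Pn. Qed.

(** One [A n] is fixed whose averages over all translates are close to [M]; for this fixed set the
    boundary term of [transfer_mean], relative to [vol (B m)], tends to 0 with [m]. *)
Lemma mean_independent A (B : (set G)^nat) g (M : R) : van_hove theta A ->
  van_hove theta B -> bmeas g ->
  tavg A g @ translates_filter setT --> M -> tavg B g @ translates_filter setT --> M.
Proof.
move=> vA vB bg.
move=> /cvgrPdist_le AM; apply/cvgrPdist_le => /= e e0.
have [_ [C gC]] := bg; have C0 : 0 <= C := le_trans (normr_ge0 _) (gC 0).
have e20 : 0 < e / 2 by rewrite divr_gt0.
have [n Hn] := @filter_ex _ \oo _ _ (AM _ e20).
have cAn : compact (closure (A n)) by rewrite -precompactE;
  exact: (van_hove_precompact vA n).
have /cvgrPdist_le := van_hove_cvg vB cAn.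
(* With this ratio the boundary term is at most [e / 2] times [vol (B m)]; the other half of [e] is
   the error of [A n]. *)
move=> /(_ (e / (4 * (C + 1)))) [|N _ HN];
  first by rewrite divr_gt0// mulr_gt0// ltr_wpDl.
exists N => // m Nm x _ /=.
have vBm := vol_van_hove_gt0 m vB; have vAn := vol_van_hove_gt0 n vA.
have := HN m Nm; rewrite /= sub0r normrN ger0_norm; last first.
  by rewrite divr_ge0// vol_ge0.
rewrite ler_pdivrMr// => bd.
have := @transfer_mean (A n) (B m) g C M (e / 2) (finite_vol_van_hove n vA).1
  (van_hove_precompact vA n) vAn (finite_vol_van_hove m vB).1 (van_hove_precompact vB
    m) bg gC _ x.
move=> H; rewrite -(ler_pM2l vBm) -{1}(ger0_norm (ltW vBm)) -normrM mulrBr tavgE// distrC.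
 apply: le_trans (H _) _.
  move=> y; have := Hn y I => /=;
    rewrite -(ler_pM2l vAn) -{1}(ger0_norm (ltW vAn)) -normrM mulrBr tavgE// distrC.
  exact.
have : C * (2 * vol (van_hove_boundary (closure (A n)) (B m))) <=
   (C + 1) * (2 * (e / (4 * (C + 1)) * vol (B m))).
  apply: ler_pM => //; [by rewrite mulr_ge0// vol_ge0|by rewrite lerDl|
    by rewrite ler_wpM2l].
have -> : (C + 1) * (2 * (e / (4 * (C + 1)) * vol (B m))) = vol (B m) * (e / 2).
  by field; rewrite lt0r_neq0// ltr_wpDl.
lra.
Qed.

End van_hove_means.

(** * Complex functions and characters *)

Section complex_functions.
Local Open Scope complex_scope.
Context {R : realType} {G : topologicalZmodType}.
Implicit Types (z w : R[i]) (f g P chi psi : G -> R[i]).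
Local Notation Re := (@complex.Re R).
Local Notation Im := (@complex.Im R).

Lemma complex_eq z w : Re z = Re w -> Im z = Im w -> z = w.
Proof. by case: z w => [a b] [c d] /= -> ->. Qed.

Lemma cabs_sqr z : cabs z ^+ 2 = Re z ^+ 2 + Im z ^+ 2.
Proof. by case: z => a b /=; rewrite sqr_sqrtr// addr_ge0// sqr_ge0. Qed.

Lemma cabs_ge0 z : 0 <= cabs z.
Proof. by case: z => a b /=; exact: sqrtr_ge0. Qed.

Lemma normr_Re_le z : `|Re z| <= cabs z.
Proof.
rewrite -(ler_pXn2r (n := 2))// ?nnegrE ?cabs_ge0//.
by rewrite cabs_sqr real_normK ?num_real// lerDl sqr_ge0.
Qed.

Lemma normr_Im_le z : `|Im z| <= cabs z.
Proof.
rewrite -(ler_pXn2r (n := 2))// ?nnegrE ?cabs_ge0//.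
by rewrite cabs_sqr real_normK ?num_real// lerDr sqr_ge0.
Qed.

Lemma cabs_le_ReIm z : cabs z <= `|Re z| + `|Im z|.
Proof.
rewrite -(ler_pXn2r (n := 2))// ?nnegrE ?cabs_ge0// ?addr_ge0//.
rewrite cabs_sqr sqrrD !real_normK ?num_real// -addrA lerD2l addrC.
by rewrite lerDl mulrn_wge0// mulr_ge0.
Qed.

Lemma ReD z w : Re (z + w) = Re z + Re w. Proof. by case: z w => [? ?] []. Qed.
Lemma ImD z w : Im (z + w) = Im z + Im w. Proof. by case: z w => [? ?] []. Qed.
Lemma ReN z : Re (- z) = - Re z. Proof. by case: z. Qed.
Lemma ImN z : Im (- z) = - Im z. Proof. by case: z. Qed.
Lemma ReM z w : Re (z * w) = Re z * Re w - Im z * Im w.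
Proof. by case: z w => [? ?] []. Qed.
Lemma ImM z w : Im (z * w) = Re z * Im w + Im z * Re w.
Proof. by case: z w => [? ?] []. Qed.
Lemma ReJ z : Re (conjc z) = Re z. Proof. by case: z. Qed.
Lemma ImJ z : Im (conjc z) = - Im z. Proof. by case: z. Qed.

Definition cE := (ReD, ImD, ReN, ImN, ReM, ImM, ReJ, ImJ).

Definition cbmeas f := bmeas (fun t => Re (f t)) /\ bmeas (fun t => Im (f t)).

Lemma cbmeasP f : cbmeas f <-> cmeasurable f /\ cbounded f.
Proof.
split=> [[[mr [M fM]] [mi [N fN]]]|[[mr mi] [M fM]]].
  split => //; exists (M + N) => t.
  by apply: le_trans (cabs_le_ReIm _) _; exact: lerD.
by split; split => //; exists M => t; apply: le_trans (fM t);
  [exact: normr_Re_le|exact: normr_Im_le].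
Qed.

Lemma cbmeas_cst z : cbmeas (fun=> z).
Proof. by split; exact: bmeas_cst. Qed.

Lemma cbmeasD f g : cbmeas f -> cbmeas g -> cbmeas (fun t => f t + g t).
Proof.
by move=> [fr fi] [gr gi]; split; under eq_fun do rewrite !cE; exact: bmeasD.
Qed.

Lemma cbmeasN f : cbmeas f -> cbmeas (fun t => - f t).
Proof. by move=> [fr fi]; split; under eq_fun do rewrite !cE; exact: bmeasN. Qed.

Lemma cbmeasB f g : cbmeas f -> cbmeas g -> cbmeas (fun t => f t - g t).
Proof. by move=> bf bg; apply: cbmeasD => //; exact: cbmeasN. Qed.

Lemma cbmeasM f g : cbmeas f -> cbmeas g -> cbmeas (fun t => f t * g t).
Proof.
move=> [fr fi] [gr gi]; split; under eq_fun do rewrite !cE.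
  by apply: bmeasB; exact: bmeasM.
by apply: bmeasD; exact: bmeasM.
Qed.

Lemma cbmeasJ f : cbmeas f -> cbmeas (fun t => conjc (f t)).
Proof. move=> [fr fi]; split; first by under eq_fun do rewrite cE.
by under eq_fun do rewrite cE; exact: bmeasN. Qed.

Lemma cbmeas_sum (I : Type) (s : seq I) (F : I -> G -> R[i]) :
  (forall i, cbmeas (F i)) -> cbmeas (fun t => \sum_(i <- s) F i t).
Proof.
move=> bF; elim: s => [|i s IH].
  by under eq_fun do rewrite big_nil; exact: cbmeas_cst.
by under eq_fun do rewrite big_cons; exact: cbmeasD.
Qed.

Lemma bmeas_cabs_sqr f : cbmeas f -> bmeas (fun t => cabs (f t) ^+ 2).
Proof.
move=> [fr fi]; under eq_fun do rewrite cabs_sqr.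
by apply: bmeasD; exact: bmeasX.
Qed.

Lemma bmeas_cabs f : cbmeas f -> bmeas (fun t => cabs (f t)).
Proof.
move=> bf; have [_ [M fM]] := (cbmeasP f).1 bf; split; last first.
  by exists M => t; rewrite ger0_norm ?cabs_ge0.
have -> : (fun t => cabs (f t)) = (fun t => Num.sqrt (cabs (f t) ^+ 2)).
  by apply/funext => t; rewrite sqrtr_sqr ger0_norm// cabs_ge0.
apply: (@measurableT_comp _ _ _ (borel G) R R Num.sqrt setT (fun t => cabs (f t) ^+ 2)).
  by apply: continuous_measurable_fun; exact: sqrt_continuous.
exact: (bmeas_cabs_sqr bf).1.
Qed.

Lemma norm_complexoE (z : R[i]^o) : `|z| = (cabs z)%:C.
Proof. by []. Qed.

Lemma complexo_cvg (T : Type) (F : set_system T) (p : T -> R[i]) z : Filter F ->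
  (p : T -> R[i]^o) @ F --> (z : R[i]^o) <->
  (fun t => Re (p t)) @ F --> Re z /\ (fun t => Im (p t)) @ F --> Im z.
Proof.
move=> FF; split.
  move=> /cvgrPdist_lt pz.
  have H (e : R) : 0 < e -> \forall t \near F, cabs (z - p t) < e.
    move=> e0; have := pz e%:C; rewrite (ltcR 0) => /(_ e0); apply: filterS => t.
    by rewrite norm_complexoE ltcR.
  split; apply/cvgrPdist_lt => e /H; apply: filterS => t; apply: le_lt_trans.
    by rewrite -ReN -ReD; exact: normr_Re_le.
  by rewrite -ImN -ImD; exact: normr_Im_le.
move=> [/cvgrPdist_lt pr /cvgrPdist_lt pi]; apply/cvgrPdist_lt => /= e e0.
(* In the order of [R[i]] positivity forces the imaginary part to vanish. *)
have [er e1] : e = (Re e)%:C /\ 0 < Re e.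
  by move: e0; rewrite ltcE => /andP[/eqP/= ei ?]; split => //; apply: complex_eq.
have e20 : 0 < Re e / 2 by rewrite divr_gt0.
apply: filterS2 (pr _ e20) (pi _ e20) => t h1 h2.
rewrite er norm_complexoE ltcR; apply: le_lt_trans (cabs_le_ReIm _) _.
by rewrite !cE (splitr (Re e)) ltrD.
Qed.

Lemma dual_continuous chi : dual_group chi ->
  continuous (fun t => Re (chi t)) /\ continuous (fun t => Im (chi t)).
Proof.
by move=> [cc _ _]; split => t; have /complexo_cvg[] := cc t.
Qed.

Lemma dual_cbmeas chi : dual_group chi -> cbmeas chi.
Proof.
move=> dc; have [cr ci] := dual_continuous dc; have [_ c1 _] := dc.
split; apply: bmeas_continuous => //; exists 1 => t; rewrite -(c1 t).
  exact: normr_Re_le.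
exact: normr_Im_le.
Qed.

Lemma dualM chi psi : dual_group chi -> dual_group psi ->
  dual_group (fun t => chi t * psi t).
Proof.
move=> dc dp; have [ccr cci] := dual_continuous dc; have [cpr cpi] := dual_continuous dp.
have [_ c1 cD] := dc; have [_ p1 pD] := dp; split.
- move=> t; apply/complexo_cvg; split.
    under eq_fun do rewrite cE; rewrite cE.
    by apply: cvgB; apply: cvgM; [exact: ccr|exact: cpr|exact: cci|exact: cpi].
  under eq_fun do rewrite cE; rewrite cE.
  by apply: cvgD; apply: cvgM; [exact: ccr|exact: cpi|exact: cci|exact: cpr].
- by move=> t; rewrite ComplexField.Normc.normcM c1 p1 mulr1.
- by move=> t u; rewrite cD pD mulrACA.
Qed.

Lemma dualJ chi : dual_group chi -> dual_group (fun t => conjc (chi t)).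
Proof.
move=> dc; have [ccr cci] := dual_continuous dc; have [_ c1 cD] := dc; split.
- move=> t; apply/complexo_cvg; split.
    by under eq_fun do rewrite cE; rewrite cE; exact: ccr.
  by under eq_fun do rewrite cE; rewrite cE; apply: cvgN; exact: cci.
- move=> t; rewrite -(c1 t); case: (chi t) => a b /=; by rewrite sqrrN.
- by move=> t u; rewrite cD rmorphM.
Qed.

Lemma dual1 : dual_group (fun _ : G => 1 : R[i]).
Proof.
split.
- by move=> t; exact: cvg_cst.
- by move=> t; rewrite ComplexField.Normc.normc1.
- by move=> t u; rewrite mulr1.
Qed.

Lemma dualMJ chi t : dual_group chi -> chi t * conjc (chi t) = 1.
Proof.
move=> [_ c1 _]; have := cabs_sqr (chi t); rewrite c1 expr1n => /esym H.
apply: complex_eq; rewrite !cE /=; last by ring.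
by rewrite mulrN opprK -!expr2.
Qed.

Lemma trig_cbmeas P : trig_poly P -> cbmeas P.
Proof.
move=> [n [c [chi [dc ->]]]]; apply: cbmeas_sum => j.
by apply: cbmeasM; [exact: cbmeas_cst|exact: dual_cbmeas].
Qed.

End complex_functions.

(** * Trigonometric polynomials and truncation *)

Section truncation.
Context {R : realType}.
Implicit Types (x y a C e : R) (n : nat).

(* Polynomials in [x] converging to [`|x|] uniformly on [[-1, 1]]. *)
Fixpoint abs_approx n x : R :=
  if n is m.+1 then abs_approx m x + (x ^+ 2 - abs_approx m x ^+ 2) / 2 else 0.

Lemma abs_approx_bound n x : `|x| <= 1 -> 0 <= abs_approx n x <= `|x|.
Proof.
move=> x1; have x0 := normr_ge0 x; elim: n => [|n /andP[h0 h1]] /=.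
  by rewrite lexx.
rewrite -(real_normK (num_real x)); apply/andP; split; nra.
Qed.

(** While the error exceeds [e], one iteration lowers it by at least [e ^+ 2 / 2]. It is at most 1
    initially and never negative, so the number of iterations is bounded uniformly in [x]. *)
Lemma abs_approx_cvg e : 0 < e ->
  exists n, forall x, `|x| <= 1 -> `| `|x| - abs_approx n x| <= e.
Proof.
move=> e0.
have H n x : `|x| <= 1 -> `|x| - abs_approx n x <= e \/
    `|x| - abs_approx n x <= 1 - n%:R * (e ^+ 2 / 2).
  move=> x1; elim: n => [|n IH] /=; first by right; rewrite subr0 mul0r subr0.
  have /andP[h0 h1] := abs_approx_bound n x1.
  rewrite -(real_normK (num_real x)) -[n.+1]addn1 natrD.
  set a : R := `|x| in x1 h1 IH *; set q := abs_approx n x in h0 h1 IH *.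
  have k1 : (a - q) ^+ 2 <= a ^+ 2 - q ^+ 2.
    have -> : a ^+ 2 - q ^+ 2 = (a - q) ^+ 2 + 2 * q * (a - q) by ring.
    by rewrite lerDl mulr_ge0 ?subr_ge0// mulr_ge0.
  have k0 : 0 <= (a - q) ^+ 2 := sqr_ge0 _.
  have [le|lt] := leP (a - q) e; first by left; lra.
  have k2 : e ^+ 2 <= (a - q) ^+ 2.
    by rewrite ler_pXn2r// ?nnegrE ?subr_ge0// ltW.
  by case: IH => IH; [lra|right; lra].
have [n Hn] : exists n : nat, 1 < n%:R * (e ^+ 2 / 2).
  have e2 : 0 < e ^+ 2 / 2 by rewrite divr_gt0// exprn_gt0.
  exists (Num.truncn (e ^+ 2 / 2)^-1).+1.
  by rewrite -ltr_pdivrMr// mul1r truncnS_gt.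
exists n => x x1; have /andP[h0 h1] := abs_approx_bound n x1.
rewrite ger0_norm ?subr_ge0//.
by case: (H n x x1) => // h; lra.
Qed.

(** Truncation to [[-C, C]] for [C >= 0], written through absolute values so that polynomials
    approximating the absolute value approximate it too. *)
Definition clip C x : R := (`|x + C| - `|x - C|) / 2.

(** Projecting [x] onto an interval that contains [y] cannot move it away from [y]. *)
Lemma clip_near C x y : `|y| <= C -> `|y - clip C x| <= `|y - x|.
Proof.
rewrite /clip ler_norml => /andP[y1 y2].
have [p|p] := ger0P (x + C); have [q|q] := ger0P (x - C); have [r|r] := ger0P (y - x);
  rewrite ler_norml; apply/andP; split; lra.
Qed.

Lemma clip_bound C x : 0 <= C -> `|clip C x| <= C.
Proof.
rewrite /clip => C0.
have [p|p] := ger0P (x + C); have [q|q] := ger0P (x - C);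
  rewrite ler_norml; apply/andP; split; lra.
Qed.

(** The arguments are divided by [b] because [abs_approx] is controlled on [[-1, 1]]; [b = B + C]
    brings [x + C] and [x - C] there when [x] is bounded by [B]. *)
Definition clip_approx n b C x : R :=
  b / 2 * (abs_approx n ((x + C) / b) - abs_approx n ((x - C) / b)).

Lemma clip_approx_cvg (B C e : R) : 0 <= B -> 0 < C -> 0 < e ->
  exists n, forall x, `|x| <= B -> `|clip C x - clip_approx n (B + C) C x| <= e.
Proof.
move=> B0 C0 e0; have b0 : 0 < B + C by rewrite ltr_wpDl.
have [n Hn] := abs_approx_cvg (divr_gt0 e0 b0); exists n => x xB.
have h y : `|y| <= B + C -> `| `|y| - (B + C) * abs_approx n (y / (B + C))| <= e.
  move=> yb; have := Hn (y / (B + C)).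
  rewrite normrM normfV (gtr0_norm b0) ler_pdivrMr// mul1r => /(_ yb).
  rewrite -(ler_pM2l b0) -{1}(gtr0_norm b0) -normrM mulrBr mulrCA divff ?lt0r_neq0//
    mulr1.
  by rewrite mulrCA divff ?lt0r_neq0// mulr1.
have /h : `|x + C| <= B + C.
  by apply: le_trans (ler_normD _ _) _; rewrite (gtr0_norm C0) lerD2r.
have /h : `|x - C| <= B + C.
  by apply: le_trans (ler_normB _ _) _; rewrite (gtr0_norm C0) lerD2r.
rewrite /clip /clip_approx.
set p := abs_approx _ _; set q := abs_approx _ _.
set u := `|x - C|; set v := `|x + C|.
rewrite !ler_norml => /andP[h1 h2] /andP[h3 h4]; apply/andP; split; lra.
Qed.

End truncation.

(** * The algebra of trigonometric polynomials *)

Section trig_algebra.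
Local Open Scope complex_scope.
Context {R : realType} {G : topologicalZmodType}.
Implicit Types (z w : R[i]) (f g P Q chi psi : G -> R[i]) (h k : G -> R).

(** Lists allow induction, and sums and products become concatenations and lists of products. *)
Lemma trig_polyP P : trig_poly P <->
  exists s : seq (R[i] * (G -> R[i])),
    (forall p, p \in s -> dual_group p.2) /\ P = (fun t => \sum_(p <- s) p.1 * p.2 t).
Proof.
split=> [[n [c [chi [dc ->]]]]|[s [ds ->]]].
  exists [seq (c j, chi j) | j <- enum 'I_n]; split; first by move=> _ /mapP[j _ ->];
    exact: dc.
  by apply/funext => t; rewrite big_map big_enum.
exists (size s), (fun j => (nth (0, fun=> 1) s j).1), (fun j => (nth (0, fun=> 1) s j).2).
split=> [j|]; first by apply: ds; exact: mem_nth.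
by apply/funext => t; rewrite (big_nth (0, fun=> 1)) big_mkord.
Qed.

Lemma trigD P Q : trig_poly P -> trig_poly Q -> trig_poly (fun t => P t + Q t).
Proof.
move=> /trig_polyP[s [ds ->]] /trig_polyP[r [dr ->]]; apply/trig_polyP.
exists (s ++ r); split; last by apply/funext => t; rewrite big_cat.
by move=> p; rewrite mem_cat => /orP[/ds|/dr].
Qed.

Lemma trigM P Q : trig_poly P -> trig_poly Q -> trig_poly (fun t => P t * Q t).
Proof.
move=> /trig_polyP[s [ds ->]] /trig_polyP[r [dr ->]]; apply/trig_polyP.
exists [seq (p.1 * q.1, (fun t => p.2 t * q.2 t)) | p <- s, q <- r]; split.
  by move=> _ /allpairsP[[p q] /= [/ds dp /dr dq ->]]; exact: dualM.
apply/funext => t; rewrite big_allpairs_dep mulr_suml; apply: eq_bigr => p _.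
by rewrite mulr_sumr; apply: eq_bigr => q _ /=; rewrite mulrACA.
Qed.

Lemma trigJ P : trig_poly P -> trig_poly (fun t => conjc (P t)).
Proof.
move=> /trig_polyP[s [ds ->]]; apply/trig_polyP.
exists [seq (conjc p.1, (fun t => conjc (p.2 t))) | p <- s]; split.
  by move=> _ /mapP[p /ds dp ->]; exact: dualJ.
apply/funext => t; rewrite big_map rmorph_sum; apply: eq_bigr => p _ /=.
by rewrite rmorphM.
Qed.

Lemma trig_cst z : trig_poly (fun _ : G => z).
Proof.
apply/trig_polyP; exists [:: (z, fun=> 1)]; split.
  by move=> p; rewrite inE => /eqP ->; exact: dual1.
by apply/funext => t; rewrite big_seq1 mulr1.
Qed.

(** The real-valued trigonometric polynomials form a ring, so polynomials such as [clip_approx] can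
    be applied to them. *)
Definition rtrig h := trig_poly (fun t => (h t)%:C : R[i]).

Lemma rtrigD h k : rtrig h -> rtrig k -> rtrig (fun t => h t + k t).
Proof. by move=> th tk; have := trigD th tk; under eq_fun do rewrite -rmorphD. Qed.

Lemma rtrigM h k : rtrig h -> rtrig k -> rtrig (fun t => h t * k t).
Proof. by move=> th tk; have := trigM th tk; under eq_fun do rewrite -rmorphM. Qed.

Lemma rtrig_cst (c : R) : rtrig (fun=> c).
Proof. exact: trig_cst. Qed.

Lemma rtrigB h k : rtrig h -> rtrig k -> rtrig (fun t => h t - k t).
Proof.
move=> th tk; have := rtrigD th (rtrigM (rtrig_cst (-1)) tk).
by under eq_fun do rewrite mulN1r.
Qed.

Lemma rtrig_abs_approx n h : rtrig h -> rtrig (fun t => abs_approx n (h t)).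
Proof.
move=> th; elim: n => [|n IH] /=; first exact: rtrig_cst.
apply: rtrigD => //; apply: rtrigM; last exact: rtrig_cst.
by under eq_fun do rewrite !expr2; apply: rtrigB; exact: rtrigM.
Qed.

Lemma rtrig_clip_approx n b C h : rtrig h -> rtrig (fun t => clip_approx n b C (h t)).
Proof.
move=> th; apply: rtrigM; first exact: rtrig_cst.
apply: rtrigB; apply: rtrig_abs_approx; apply: rtrigM; try exact: rtrig_cst.
  by apply: rtrigD => //; exact: rtrig_cst.
by apply: rtrigB => //; exact: rtrig_cst.
Qed.

Lemma rtrig_Re P : trig_poly P -> rtrig (fun t => complex.Re (P t)).
Proof.
move=> tP; have := trigM (trigD tP (trigJ tP)) (trig_cst 2^-1).
by rewrite /rtrig; under [X in _ -> trig_poly X]eq_fun do rewrite ReJ_add.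
Qed.

Lemma rtrig_Im P : trig_poly P -> rtrig (fun t => complex.Im (P t)).
Proof.
(* Multiplication by [-i] turns the imaginary part into the real part. *)
move=> tP; have := rtrig_Re (trigM tP (trig_cst (0 -i* 1))).
by under eq_fun do rewrite cE /= mulr0 sub0r mulrN1 opprK.
Qed.

Lemma trig_ReIm h k : rtrig h -> rtrig k -> trig_poly (fun t => h t +i* k t).
Proof.
move=> th tk; have := trigD th (trigM (trig_cst 'i) tk).
by congr trig_poly; apply/funext => t; rewrite [RHS]complexE.
Qed.

End trig_algebra.

(** * Means, Bessel's inequality and Parseval's identity *)

Section folner_means.
Local Open Scope complex_scope.
Context {R : realType} {G : topologicalZmodType}.
Context {theta : {measure set (borel G) -> \bar R}}.
Context {I : Type} {F : set_system I} {FF : ProperFilter F} {S : I -> set G}.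
Hypothesis haar_theta : haar_measure theta.
Hypothesis fS : forall i, finite_vol (theta := theta) (S i).
Hypothesis S_gt0 : forall i, 0 < vol theta (S i).
Hypothesis folner : forall u,
  (fun i => vol theta (translate u (S i) `\` S i) / vol theta (S i)) @ F --> (0 : R).
Implicit Types (z w m : R[i]) (f g P chi psi : G -> R[i]) (h k : G -> R) (i : I).
Local Notation Re := (@complex.Re R).
Local Notation Im := (@complex.Im R).

Local Notation vol := (vol theta).
Local Notation J S g := (\int[theta]_(t in (S : set (borel G))) g t).

Definition av h i : R := average theta (S i) (S i) h.

Lemma vol_unit i : vol (S i) != 0.
Proof. by rewrite lt0r_neq0. Qed.

Lemma avD h k i : bmeas h -> bmeas k -> av (fun t => h t + k t) i = av h i + av k i.
Proof. by move=> bh bk; rewrite /av /average bRintegralD// mulrDr. Qed.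

Lemma avB h k i : bmeas h -> bmeas k -> av (fun t => h t - k t) i = av h i - av k i.
Proof. by move=> bh bk; rewrite /av /average bRintegralB// mulrBr. Qed.

Lemma avZ c h i : bmeas h -> av (fun t => c * h t) i = c * av h i.
Proof. by move=> bh; rewrite /av /average bRintegralZ// mulrCA. Qed.

Lemma av_cst c i : av (fun=> c) i = c.
Proof. by rewrite /av /average bRintegral_cst// mulrCA mulVf ?mulr1// vol_unit. Qed.

Lemma av_le h k i : bmeas h -> bmeas k -> (forall t, h t <= k t) -> av h i <= av k i.
Proof. by move=> bh bk hk; rewrite /av /average ler_pM2l ?invr_gt0//;
  exact: le_bRintegral. Qed.

Lemma av_norm h i : bmeas h -> `|av h i| <= av (fun t => `|h t|) i.
Proof.
move=> bh; rewrite /av /average normrM ger0_norm ?invr_ge0 ?(ltW (S_gt0 _))//.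
by rewrite ler_pM2l ?invr_gt0//; exact: le_norm_bRintegral.
Qed.

Lemma av_ge0 h i : bmeas h -> (forall t, 0 <= h t) -> 0 <= av h i.
Proof. by move=> bh h0; rewrite -(av_cst 0 i); apply: av_le => //; exact: bmeas_cst. Qed.

Lemma av_near h k i : bmeas h -> bmeas k -> `|av h i - av k i| <= av (fun t => `|
  h t - k t|) i.
Proof. by move=> bh bk; rewrite -avB//; apply: av_norm; exact: bmeasB. Qed.

(** Shifting the integrand amounts to translating the set, which by [folner] is negligible for a
    bounded function. *)
Lemma av_shift h u : bmeas h -> av (fun t => h (u + t) - h t) @ F --> (0 : R).
Proof.
move=> bh; have [_ [M hM]] := bh.
have cM : (fun i => 2 * M * (vol (translate u (S i) `\` S i) / vol (S i))) @ F --> (0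
  : R).
  by rewrite -(mulr0 (2 * M)); apply: cvgMr; exact: folner.
apply/cvgrPdist_le => e e0; move/cvgrPdist_le : cM => /(_ e e0); apply: filterS => i.
rewrite !sub0r !normrN => H; apply: le_trans (le_trans (ler_norm _) H).
have -> : av (fun t => h (u + t) - h t) i =
  (vol (S i))^-1 * (J (translate u (S i)) h - J (S i) h).
  rewrite /av /average bRintegralB//; last exact: bmeas_shift.
  by rewrite -bRintegral_translate.
rewrite normrM ger0_norm ?invr_ge0 ?(ltW (S_gt0 _))// mulrA mulrC ler_pM2r ?invr_gt0//.
rewrite -mulrA mulrCA; have := bRintegral_translate_near haar_theta 0 u (fS i) bh hM.
by rewrite translate0.
Qed.

Definition mean f m : Prop :=
  av (fun t => Re (f t)) @ F --> Re m /\ av (fun t => Im (f t)) @ F --> Im m.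

Lemma mean_unique f z w : mean f z -> mean f w -> z = w.
Proof.
by move=> [zr zi] [wr wi]; apply: complex_eq;
  [exact: (cvg_unique _ zr wr)|exact: (cvg_unique _ zi wi)].
Qed.

Lemma mean_cst z : mean (fun=> z) z.
Proof. by split; apply: cvg_near_cst; apply: nearW => i; rewrite av_cst. Qed.

Lemma meanD f g z w : cbmeas f -> cbmeas g -> mean f z -> mean g w ->
  mean (fun t => f t + g t) (z + w).
Proof.
move=> [fr fi] [gr gi] [zr zi] [wr wi]; split.
  have -> : av (fun t => Re (f t + g t)) =
    (fun i => av (fun t => Re (f t)) i + av (fun t => Re (g t)) i).
    by apply/funext => i; under [X in av X]eq_fun do rewrite cE; rewrite avD.
  by rewrite cE; exact: cvgD.
have -> : av (fun t => Im (f t + g t)) =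
  (fun i => av (fun t => Im (f t)) i + av (fun t => Im (g t)) i).
  by apply/funext => i; under [X in av X]eq_fun do rewrite cE; rewrite avD.
by rewrite cE; exact: cvgD.
Qed.

Lemma meanZ f c z : cbmeas f -> mean f z -> mean (fun t => c * f t) (c * z).
Proof.
move=> [fr fi] [zr zi]; split.
  have -> : av (fun t => Re (c * f t)) =
    (fun i => Re c * av (fun t => Re (f t)) i - Im c * av (fun t => Im (f t)) i).
    apply/funext => i; under [X in av X]eq_fun do rewrite cE; rewrite -!avZ// -avB//;
    by apply: bmeasM => //; exact: bmeas_cst.
  by rewrite cE; apply: cvgB; exact: cvgMr.
have -> : av (fun t => Im (c * f t)) =
  (fun i => Re c * av (fun t => Im (f t)) i + Im c * av (fun t => Re (f t)) i).
  apply/funext => i; under [X in av X]eq_fun do rewrite cE; rewrite -!avZ// -avD//;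
  by apply: bmeasM => //; exact: bmeas_cst.
by rewrite cE; apply: cvgD; exact: cvgMr.
Qed.

Lemma meanB f g z w : cbmeas f -> cbmeas g -> mean f z -> mean g w ->
  mean (fun t => f t - g t) (z - w).
Proof.
move=> bf bg fz gw.
have bNg : cbmeas (fun t => -1 * g t) by apply: cbmeasM => //; exact: cbmeas_cst.
have := meanD bf bNg fz (meanZ (-1) bg gw).
by under eq_fun do rewrite mulN1r; rewrite mulN1r.
Qed.

(** Shifting by [u] multiplies [chi] by [chi u] but does not affect means, so [(chi u - 1) * chi t]
    has mean 0, and the constant factor is invertible. *)
Lemma mean_dual chi u : dual_group chi -> chi u != 1 -> mean chi 0.
Proof.
move=> dc u1; have [_ _ cD] := dc; have [cr ci] := dual_cbmeas dc.
have H : mean (fun t => chi (u + t) - chi t) 0.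
  split => /=; first by under [X in av X]eq_fun do rewrite !cE; exact: av_shift.
  by under [X in av X]eq_fun do rewrite !cE; exact: av_shift.
have b : cbmeas (fun t => chi (u + t) - chi t).
  by apply: cbmeasB => //; split; [exact: (bmeas_shift u cr)|exact: (bmeas_shift u ci)].
have := meanZ (chi u - 1)^-1 b H; rewrite mulr0.
congr mean; apply/funext => t.
rewrite cD (_ : chi u * chi t - chi t = (chi u - 1) * chi t).
  by rewrite mulKf// subr_eq0.
by rewrite mulrBl mul1r.
Qed.

(** Orthogonality: the quotient of two distinct characters is a nontrivial character. *)
Lemma mean_dual_neq chi psi : dual_group chi -> dual_group psi -> chi != psi ->
  mean (fun t => chi t * conjc (psi t)) 0.
Proof.
move=> dc dp ne; have /existsNP[u Hu] : ~ forall t, chi t = psi t.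
  by move=> E; move/eqP: ne; apply; exact/funext.
apply: (@mean_dual _ u); first by apply: dualM => //; exact: dualJ.
apply/eqP => E; apply: Hu.
by rewrite -[LHS]mulr1 -(dualMJ u dp) (mulrC (psi u)) mulrA E mul1r.
Qed.

(** * Subtraction of characters, Bessel's inequality and Parseval's identity *)

Definition spectrum f (a : (G -> R[i]) -> R[i]) (M : R) : Prop :=
  [/\ cbmeas f, forall chi, dual_group chi ->
    mean (fun t => f t * conjc (chi t)) (a chi) &
      av (fun t => cabs (f t) ^+ 2) @ F --> M].

(** Orthogonality confines the change to the coefficient at [chi]. The new mean square comes from
    expanding the square, then completing the square in [c]. *)
Lemma spectrum_sub f a M chi c : spectrum f a M -> dual_group chi ->
  spectrum (fun t => f t - c * chi t) (fun psi => a psi - (if psi == chi then c else 0))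
    (M - cabs (a chi) ^+ 2 + cabs (a chi - c) ^+ 2).
Proof.
move=> [bf fa fM] dc; have bc := dual_cbmeas dc.
have bcc : cbmeas (fun t => c * chi t) by apply: cbmeasM => //; exact: cbmeas_cst.
split; first exact: cbmeasB.
- move=> psi dp; have bp := cbmeasJ (dual_cbmeas dp).
  under eq_fun do rewrite mulrBl -mulrA.
  have bcp : cbmeas (fun t => chi t * conjc (psi t)) by exact: cbmeasM.
  apply: meanB; [exact: cbmeasM|by apply: cbmeasM => //; exact: cbmeas_cst|exact: fa|].
  have [->|ne] := eqVneq psi chi.
    by under eq_fun do rewrite dualMJ// mulr1; exact: mean_cst.
  by rewrite -(mulr0 c); apply: meanZ => //; apply: mean_dual_neq => //; rewrite eq_sym.
- have bfc : cbmeas (fun t => f t * conjc (chi t)) by apply: cbmeasM => //;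
  exact: cbmeasJ.
  have bC : cbmeas (fun t => conjc c * (f t * conjc (chi t))).
    by apply: cbmeasM => //; exact: cbmeas_cst.
  have E t : cabs (f t - c * chi t) ^+ 2 =
      cabs (f t) ^+ 2 - 2 * Re (conjc c * (f t * conjc (chi t))) + cabs c ^+ 2.
    have := dualMJ t dc => /(congr1 Re); rewrite !cE /= => chi1.
    rewrite -[in RHS](mulr1 (cabs c ^+ 2)) -[X in _ = _ + _ * X]chi1.
    by rewrite !cabs_sqr !cE; ring.
  have -> : av (fun t => cabs (f t - c * chi t) ^+ 2) =
     (fun i => av (fun t => cabs (f t) ^+ 2) i -
               2 * av (fun t => Re (conjc c * (f t * conjc (chi t)))) i + cabs c ^+ 2).
    apply/funext => i; rewrite (_ : (fun t => _) =
      (fun t => cabs (f t) ^+ 2 - 2 * Re (conjc c * (f t * conjc (chi t))) + cabs c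
        ^+ 2)); last exact/funext.
    have b2 : bmeas (fun t => 2 * Re (conjc c * (f t * conjc (chi t)))).
      by apply: bmeasM; [exact: bmeas_cst|exact: bC.1].
    rewrite avD; [|by apply: bmeasB => //; exact: bmeas_cabs_sqr|exact: bmeas_cst].
    by rewrite avB//; [rewrite avZ ?av_cst//; exact: bC.1|exact: bmeas_cabs_sqr].
  have -> : M - cabs (a chi) ^+ 2 + cabs (a chi - c) ^+ 2 =
    M - 2 * Re (conjc c * a chi) + cabs c ^+ 2.
    by rewrite !cabs_sqr !cE; ring.
  apply: cvgD; last exact: cvg_cst.
  by apply: cvgB => //; apply: cvgMr; exact: (meanZ _ bfc (fa _ dc)).1.
Qed.

Lemma spectrum_ge0 f a M : spectrum f a M -> 0 <= M.
Proof.
move=> [bf _ fM]; apply: (cvgr_to_ge fM); apply: nearW => i.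
by apply: av_ge0; [exact: bmeas_cabs_sqr|move=> t; exact: sqr_ge0].
Qed.

(** The characters are subtracted one at a time with [c = a chi], which kills that coefficient and
    lowers the mean square by [cabs (a chi) ^+ 2]. As [s] has no repetition, the coefficient at
    [chi] is still [a chi] when its turn comes. *)
Lemma spectrum_sub_seq f a M (s : seq (G -> R[i])) : spectrum f a M ->
  uniq s -> (forall chi, chi \in s -> dual_group chi) ->
  spectrum (fun t => f t - \sum_(chi <- s) a chi * chi t)
    (fun psi => if psi \in s then 0 else a psi) (M - \sum_(chi <- s) cabs (a chi) ^+ 2).
Proof.
move=> sf; elim: s => [_ _|chi s IH /= /andP[chis us] ds].
  by rewrite big_nil subr0; under eq_fun do rewrite big_nil subr0.
have /IH {}IH : forall psi, psi \in s -> dual_group psi.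
  by move=> psi ps; apply: ds; rewrite inE ps orbT.
have dc : dual_group chi by apply: ds; rewrite inE eqxx.
have := spectrum_sub (a chi) (IH us) dc; rewrite (negbTE chis) subrr.
rewrite [cabs 0]ComplexField.Normc.normc0 expr0n addr0 big_cons opprD addrAC addrA.
congr spectrum.
- by apply/funext => t; rewrite big_cons opprD addrAC addrA.
- apply/funext => psi; rewrite inE; have [->|_] := eqVneq psi chi; last by rewrite subr0.
  by rewrite (negbTE chis) subrr.
Qed.

(** The mean square of the remainder is nonnegative. *)
Lemma spectrum_bessel f a M (s : seq (G -> R[i])) : spectrum f a M ->
  uniq s -> (forall chi, chi \in s -> dual_group chi) ->
  \sum_(chi <- s) cabs (a chi) ^+ 2 <= M.
Proof. by move=> sf us ds; rewrite -subr_ge0;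
  exact: spectrum_ge0 (spectrum_sub_seq sf us ds). Qed.

(* The squared distance to the span of [s] does not change when an element of that
   span is subtracted. *)
Lemma spectrum_sub_trig f a M (s : seq (G -> R[i])) (p : seq (R[i] * (G -> R[i]))) :
  spectrum f a M -> uniq s -> (forall chi, chi \in s -> dual_group chi) ->
  (forall q, q \in p -> q.2 \in s) ->
  exists b N, spectrum (fun t => f t - \sum_(q <- p) q.1 * q.2 t) b N /\
    N - \sum_(chi <- s) cabs (b chi) ^+ 2 = M - \sum_(chi <- s) cabs (a chi) ^+ 2.
Proof.
move=> sf us ds; elim: p => [_|[c chi] p IH ps].
  by exists a, M; under eq_fun do rewrite big_nil subr0.
have [|b [N [sb eN]]] := IH; first by move=> q qp; apply: ps; rewrite inE qp orbT.
have cs : chi \in s by apply: (ps (c, chi)); rewrite inE eqxx.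
have := spectrum_sub c sb (ds _ cs).
set b' := (fun psi => _); set N' := (_ + _) => sb'; exists b', N'; split.
  by move: sb'; congr spectrum; apply/funext => t; rewrite big_cons /= opprD addrAC addrA.
rewrite -eN /N' (bigD1_seq chi cs us) [in RHS](bigD1_seq chi cs us) /=.
rewrite [X in _ - (_ + X)](eq_bigr (fun psi => cabs (b psi) ^+ 2)).
  by rewrite /b' eqxx; ring.
by move=> psi /negbTE ne; rewrite /b' ne subr0.
Qed.

(** [f - Q] has mean square at most [e], which bounds its squared distance to the span of the
    characters of [Q]; that distance is the same for [f]. *)
Lemma spectrum_trig_le f a M Q (e : R) : spectrum f a M -> trig_poly Q ->
  (\forall i \near F, av (fun t => cabs (f t - Q t) ^+ 2) i <= e) ->
  exists s : seq (G -> R[i]), [/\ uniq s, forall chi, chi \in s -> dual_group chi &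
    M - \sum_(chi <- s) cabs (a chi) ^+ 2 <= e].
Proof.
move=> sf /trig_polyP[p [dp ->]] Qe; exists (undup [seq q.2 | q <- p]); split.
- exact: undup_uniq.
- by move=> chi; rewrite mem_undup => /mapP[q qp ->]; exact: dp.
- have [||q qp|b [N [sb <-]]] := @spectrum_sub_trig f a M (undup [seq q.2 | q <- p]) p sf.
  + exact: undup_uniq.
  + by move=> chi; rewrite mem_undup => /mapP[q qp ->]; exact: dp.
  + by rewrite mem_undup; apply/mapP; exists q.
  + have [_ _ bN] := sb; apply: le_trans (cvgr_to_le bN Qe).
    by rewrite lerBlDr lerDl sumr_ge0// => chi _; exact: sqr_ge0.
Qed.

(** The sum is a supremum over finite sets of characters, so the identity splits into Bessel's
    inequality and the existence of finite sums within any [e] of [M]. *)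
Lemma parsevalP (a : (G -> R[i]) -> R[i]) (M : R) :
  parseval a M <->
  (forall s : seq (G -> R[i]), uniq s -> (forall chi, chi \in s -> dual_group chi) ->
     \sum_(chi <- s) cabs (a chi) ^+ 2 <= M) /\
  (forall e : R, 0 < e -> exists s : seq (G -> R[i]),
    [/\ uniq s, forall chi, chi \in s -> dual_group chi &
        M - \sum_(chi <- s) cabs (a chi) ^+ 2 <= e]).
Proof.
pose u := (fun chi => (cabs (a chi) ^+ 2)%:E : \bar R).
have sumE (s : seq (G -> R[i])) : (\sum_(chi <- s) u chi)%E =
  (\sum_(chi <- s) cabs (a chi) ^+ 2)%:E.
  by rewrite sumEFin.
have ub (s : seq (G -> R[i])) : uniq s -> (forall chi, chi \in s -> dual_group chi) ->
    ((\sum_(chi <- s) cabs (a chi) ^+ 2)%:E <= \esum_(chi in @dual_group R G) u chi)%E.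
  move=> us ds; apply: ereal_sup_ubound; exists [set` s].
    by split; [exact: finite_seq|move=> chi; exact: ds].
  by rewrite -fsbig_seq// sumE.
split=> [pM|[le_M M_le]].
  split=> [s us ds|e e0]; first by rewrite -lee_fin -pM; exact: ub.
  have fin : \esum_(chi in @dual_group R G) u chi \is a fin_num by rewrite /u pM.
  have [_ [B [fB Bd] <-]] := ub_ereal_sup_adherent e0 fin.
  rewrite fsbig_finite// -/(esum _ _) [esum _ _]pM => lt.
  exists (finmap.enum_fset (fset_set B)); split.
  - exact: finmap.fset_uniq.
  - by move=> chi; rewrite in_fset_set// => /set_mem /Bd.
  - by move: lt; rewrite sumE -EFinB lte_fin => /ltW; rewrite lerBlDr lerBlDl.
rewrite /parseval; apply/eqP; rewrite eq_le; apply/andP; split.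
  apply: ge_ereal_sup => _ [B [fB Bd] <-].
  rewrite fsbig_finite// sumE lee_fin; apply: le_M; first exact: finmap.fset_uniq.
  by move=> chi; rewrite in_fset_set// => /set_mem /Bd.
apply/lee_addgt0Pr => e e0; have [s [us ds Ms]] := M_le _ e0.
apply: le_trans (leeD (ub s us ds) (lexx _)).
by rewrite -EFinD lee_fin -lerBlDl.
Qed.

Lemma spectrum_approx f a M (e : R) : spectrum f a M -> parseval a M -> 0 < e ->
  exists2 P, trig_poly P & \forall i \near F, av (fun t => cabs (f t - P t) ^+ 2) i <= e.
Proof.
move=> sf /parsevalP[_ M_le] e0.
have [s [us ds Ms]] := M_le (e / 2) (divr_gt0 e0 (ltr0n _ 2)).
have [_ _ /cvgrPdist_le H] := spectrum_sub_seq sf us ds.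
exists (fun t => \sum_(chi <- s) a chi * chi t).
  apply/trig_polyP; exists [seq (a chi, chi) | chi <- s]; split.
    by move=> _ /mapP[chi /ds dc ->].
  by apply/funext => t; rewrite big_map.
apply: filterS (H (e / 2) (divr_gt0 e0 (ltr0n _ 2))) => i.
by rewrite ler_norml => /andP[h1 h2]; lra.
Qed.

(** Such a [u] is Cauchy along [F], and [R] is complete. *)
Lemma cvg_of_approx (u : I -> R) :
  (forall e : R, 0 < e -> exists v l, (v : I -> R) @ F --> (l : R) /\
     \forall i \near F, `|u i - v i| <= e) ->
  exists l, u @ F --> (l : R).
Proof.
move=> H; suff /cvg_ex[l ul] : cvg (u @ F) by exists l.
apply/cauchy_cvgP/cauchy_exP => e e0; have e20 : 0 < e / 2 by rewrite divr_gt0.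
have [v [l [vl uv]]] := H (e / 2) e20; exists l.
move/cvgrPdist_lt : vl => /(_ _ e20); apply: filterS2 uv => i h1 h2.
rewrite /ball /= (splitr e) -(subrKA (v i)); apply: le_lt_trans (ler_normD _ _) _.
by rewrite ltr_leD// distrC.
Qed.

Lemma mean_of_approx f : cbmeas f ->
  (forall e : R, 0 < e -> exists g m, [/\ cbmeas g, mean g m &
     \forall i \near F, av (fun t => cabs (f t - g t)) i <= e]) ->
  exists m, mean f m.
Proof.
move=> bf H; have [fr fi] := bf.
have [|lr hr] := @cvg_of_approx (av (fun t => Re (f t))).
  move=> e e0; have [g [m [bg [mr mi] fg]]] := H e e0; have [gr gi] := bg.
  exists (av (fun t => Re (g t))), (Re m); split => //; apply: filterS fg => i.
  apply: le_trans; apply: le_trans (av_near i fr gr) _; apply: av_le.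
  - by apply: bmeas_norm; exact: bmeasB.
  - by apply: bmeas_cabs; exact: cbmeasB.
  - by move=> t; rewrite -ReN -ReD; exact: normr_Re_le.
have [|li hi] := @cvg_of_approx (av (fun t => Im (f t))).
  move=> e e0; have [g [m [bg [mr mi] fg]]] := H e e0; have [gr gi] := bg.
  exists (av (fun t => Im (g t))), (Im m); split => //; apply: filterS fg => i.
  apply: le_trans; apply: le_trans (av_near i fi gi) _; apply: av_le.
  - by apply: bmeas_norm; exact: bmeasB.
  - by apply: bmeas_cabs; exact: cbmeasB.
  - by move=> t; rewrite -ImN -ImD; exact: normr_Im_le.
by exists (lr +i* li).
Qed.

(** * Approximation in mean and in mean square *)

Definition mean_approx f := forall e : R, 0 < e -> exists2 P, trig_poly P &
  \forall i \near F, av (fun t => cabs (f t - P t)) i <= e.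

Definition mean2_approx f := forall e : R, 0 < e -> exists2 P, trig_poly P &
  \forall i \near F, av (fun t => cabs (f t - P t) ^+ 2) i <= e.

(** The inequality [x <= e / 2 + x ^+ 2 / (2 * e)] takes the place of Cauchy-Schwarz: mean square at
    most [e ^+ 2] gives mean at most [e]. *)
Lemma mean2_approxW f : cbmeas f -> mean2_approx f -> mean_approx f.
Proof.
move=> bf fP e e0; have [P tP HP] := fP (e ^+ 2) (exprn_gt0 2 e0).
have bh : cbmeas (fun t => f t - P t) by apply: cbmeasB => //; exact: trig_cbmeas.
have b2 : bmeas (fun t => (2 * e)^-1 * cabs (f t - P t) ^+ 2).
  by apply: bmeasM; [exact: bmeas_cst|exact: bmeas_cabs_sqr].
exists P => //; apply: filterS HP => i Hi.
apply: (@le_trans _ _ (av (fun t => e / 2 + (2 * e)^-1 * cabs (f t - P t) ^+ 2) i)).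
  apply: av_le; [exact: bmeas_cabs|by apply: bmeasD => //; exact: bmeas_cst|].
  move=> t; set x := cabs _; have h0 : 0 <= (e - x) ^+ 2 := sqr_ge0 _.
  rewrite -subr_ge0 (_ : e / 2 + _ - x = (e - x) ^+ 2 / (2 * e)).
    by rewrite pmulr_lge0// invr_gt0 mulr_gt0.
  by field; rewrite lt0r_neq0.
rewrite avD//; last exact: bmeas_cst.
rewrite av_cst avZ; last exact: bmeas_cabs_sqr.
rewrite [leRHS]splitr lerD2l mulrC ler_pdivrMr ?mulr_gt0//.
by rewrite (_ : e / 2 * (2 * e) = e ^+ 2)//; field.
Qed.

(** Once [P] is truncated, its difference from [f] is bounded, so the square is at most a constant
    times the modulus. Real and imaginary parts are truncated separately, each truncation being
    replaced by a polynomial within [d]. *)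
Lemma mean_approx2 f : cbmeas f -> mean_approx f -> mean2_approx f.
Proof.
move=> bf fP e e0; have [[_ [M frM]] [_ [N fiN]]] := bf.
have M0 : 0 <= M := le_trans (normr_ge0 _) (frM 0).
have N0 : 0 <= N := le_trans (normr_ge0 _) (fiN 0).
pose C := M + N + 1; have C0 : 0 < C by rewrite /C; lra.
(* The bound 1 keeps differences below [2 * C + 1]; the other makes [2 * (C + 1) * (6 * d)], which
   dominates the final estimate, at most [e]. *)
pose d := Num.min 1 (e / (12 * (C + 1))).
have d0 : 0 < d by rewrite lt_min ltr01/= divr_gt0// mulr_gt0// addr_gt0.
have [P tP HP] := fP d d0.
have bP := trig_cbmeas tP; have [[_ [U PrU]] [_ [V PiV]]] := bP.
have U0 : 0 <= U := le_trans (normr_ge0 _) (PrU 0).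
have V0 : 0 <= V := le_trans (normr_ge0 _) (PiV 0).
have [n Hn] := clip_approx_cvg U0 C0 d0; have [m Hm] := clip_approx_cvg V0 C0 d0.
pose q t := clip_approx n (U + C) C (Re (P t)).
pose r t := clip_approx m (V + C) C (Im (P t)).
have tQ : trig_poly (fun t => q t +i* r t).
  by apply: trig_ReIm; apply: rtrig_clip_approx; [exact: rtrig_Re|exact: rtrig_Im].
exists (fun t => q t +i* r t) => //; apply: filterS HP => i Hi.
have bh : cbmeas (fun t => f t - P t) by exact: cbmeasB.
(* Here [x], [y] and [z] stand for the same part of [P], of [f] and of the new polynomial. One
   factor of the square is bounded by [2 * C + 1], the other by the distance. *)
have key (x y z : R) : `|y| <= C -> `|clip C x - z| <= d ->
    (y - z) ^+ 2 <= (2 * C + 1) * (`|y - x| + d).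
  move=> yC xz; have y1 := clip_near x yC; have y2 := clip_bound x (ltW C0).
  have d1 : d <= 1 by rewrite /d ge_min lexx.
  have h1 : `|y - z| <= `|y - x| + d.
    by rewrite -(subrKA (clip C x)); apply: le_trans (ler_normD _ _) _; exact: lerD.
  have h2 : `|y - z| <= 2 * C + 1.
    rewrite -(subrKA (clip C x)); apply: le_trans (ler_normD _ _) _; apply: lerD;
      last exact: le_trans xz d1.
    by apply: le_trans (ler_normB _ _) _; lra.
  by rewrite -real_normK ?num_real// expr2 ler_pM.
apply: (@le_trans _ _ (av (fun t => (2 * C + 1) * (2 * d + 2 * cabs (f t - P t))) i)).
  have bc : bmeas (fun t => 2 * d + 2 * cabs (f t - P t)).
    by apply: bmeasD; [exact: bmeas_cst|apply: bmeasM;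
      [exact: bmeas_cst|exact: bmeas_cabs]].
  apply: av_le; [by apply: bmeas_cabs_sqr; apply: cbmeasB => //;
    exact: trig_cbmeas|by apply: bmeasM => //; exact: bmeas_cst|].
  move=> t; rewrite cabs_sqr !cE /=.
  have k1 : (Re (f t) - q t) ^+ 2 <= (2 * C + 1) * (`|Re (f t) - Re (P t)| + d).
    by apply: key; [apply: le_trans (frM t) _; rewrite /C; lra|exact: Hn].
  have k2 : (Im (f t) - r t) ^+ 2 <= (2 * C + 1) * (`|Im (f t) - Im (P t)| + d).
    by apply: key; [apply: le_trans (fiN t) _; rewrite /C; lra|exact: Hm].
  apply: le_trans (lerD k1 k2) _; rewrite -mulrDr ler_pM2l; last by lra.
  have := normr_Re_le (f t - P t); have := normr_Im_le (f t - P t).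
  by rewrite !cE; lra.
have bc : bmeas (fun t => 2 * cabs (f t - P t)).
  by apply: bmeasM; [exact: bmeas_cst|exact: bmeas_cabs].
rewrite avZ; last by apply: bmeasD => //; exact: bmeas_cst.
rewrite avD//; last exact: bmeas_cst.
rewrite av_cst avZ; last exact: bmeas_cabs.
have av0 : 0 <= av (fun t => cabs (f t - P t)) i.
  by apply: av_ge0; [exact: bmeas_cabs|move=> t; exact: cabs_ge0].
apply: (@le_trans _ _ ((2 * (C + 1)) * (6 * d))).
  by apply: ler_pM; lra.
have : d <= e / (12 * (C + 1)) by rewrite /d ge_min lexx orbT.
rewrite ler_pdivlMr; last by lra.
by lra.
Qed.

Lemma trig_mean P : trig_poly P -> exists m, mean P m.
Proof.
move=> /trig_polyP[p [dp ->]]; elim: p dp => [|[c chi] p IH] dp.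
  by exists 0; under eq_fun do rewrite big_nil; exact: mean_cst.
have [|m Hm] := IH; first by move=> q qp; apply: dp; rewrite inE qp orbT.
have dc : dual_group chi by apply: (dp (c, chi)); rewrite inE eqxx.
have [z Hz] : exists z, mean chi z.
  have [e|ne] := eqVneq chi (fun=> 1); first by exists 1; rewrite e; exact: mean_cst.
  exists 0; have := mean_dual_neq dc (@dual1 R G) ne.
  by under eq_fun do rewrite conjc1 mulr1.
exists (c * z + m); under eq_fun do rewrite big_cons /=.
have bt : cbmeas (fun t => \sum_(q <- p) q.1 * q.2 t).
  apply: trig_cbmeas; apply/trig_polyP; exists p; split => // q qp.
  by apply: dp; rewrite inE qp orbT.
apply: meanD => //; last exact: meanZ (dual_cbmeas dc) Hz.
by apply: cbmeasM; [exact: cbmeas_cst|exact: dual_cbmeas].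
Qed.

(** As [chi] has modulus 1, the product of [P] with the conjugate character approximates that of [f]
    equally well, and it is again a trigonometric polynomial. *)
Lemma mean_coeff f chi : cbmeas f -> mean_approx f -> dual_group chi ->
  exists m, mean (fun t => f t * conjc (chi t)) m.
Proof.
move=> bf fP dc; have dcJ := dualJ dc; have bJ := dual_cbmeas dcJ.
apply: mean_of_approx => [|e e0]; first exact: cbmeasM.
have [P tP HP] := fP e e0.
have tPc : trig_poly (fun t => P t * conjc (chi t)).
  apply: trigM => //; apply/trig_polyP; exists [:: (1, fun t => conjc (chi t))]; split.
    by move=> q; rewrite inE => /eqP ->.
  by apply/funext => t; rewrite big_seq1 mul1r.
have [m Hm] := trig_mean tPc.
exists (fun t => P t * conjc (chi t)), m; split => //; first exact: trig_cbmeas.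
apply: filterS HP => i; congr (av _ i <= _); apply/funext => t.
by rewrite -mulrBl ComplexField.Normc.normcM; have [_ -> _] := dcJ; rewrite mulr1.
Qed.

(** The product of [f] and [conjc f] is approximated by that of [f] and [conjc P], whose mean is a
    finite combination of Fourier--Bohr coefficients of [f]. *)
Lemma mean_sqr f : cbmeas f -> mean_approx f ->
  exists M, av (fun t => cabs (f t) ^+ 2) @ F --> (M : R).
Proof.
move=> bf fP; have bfJ := cbmeasJ bf.
suff [m [mr _]] : exists m, mean (fun t => f t * conjc (f t)) m.
  exists (Re m); rewrite (_ : (fun t => _) = (fun t => Re (f t * conjc (f t))))//.
  by apply/funext => t; rewrite cabs_sqr !cE; ring.
have [_ [C fC]] := (cbmeasP f).1 bf.
have C0 : 0 <= C := le_trans (cabs_ge0 _) (fC 0).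
apply: mean_of_approx => [|e e0]; first exact: cbmeasM.
(* The error gets multiplied by the modulus of [f], at most [C]; the divisor [C + 1] also covers
   [C = 0]. *)
have [P tP HP] := fP (e / (C + 1)) (divr_gt0 e0 (ltr_wpDl C0 ltr01)).
have bP := trig_cbmeas tP.
have [m Hm] : exists m, mean (fun t => f t * conjc (P t)) m.
  move: tP => /trig_polyP[p [dp ->]] {HP bP P}; elim: p dp => [|[c chi] p IH] dp.
    by exists 0; under eq_fun do rewrite big_nil conjc0 mulr0; exact: mean_cst.
  have [|m Hm] := IH; first by move=> q qp; apply: dp; rewrite inE qp orbT.
  have dc : dual_group chi by apply: (dp (c, chi)); rewrite inE eqxx.
  have [z Hz] := mean_coeff bf fP dc.
  have bfc : cbmeas (fun t => f t * conjc (chi t)).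
    by apply: cbmeasM => //; apply: cbmeasJ; exact: dual_cbmeas.
  exists (conjc c * z + m); under eq_fun do rewrite big_cons /= rmorphD rmorphM
    mulrDr mulrCA.
  have bt : cbmeas (fun t => \sum_(q <- p) q.1 * q.2 t).
    apply: trig_cbmeas; apply/trig_polyP; exists p; split => // q qp.
    by apply: dp; rewrite inE qp orbT.
  apply: meanD => //; [by apply: cbmeasM => //;
    exact: cbmeas_cst|by apply: cbmeasM => //; exact: cbmeasJ|exact: meanZ].
exists (fun t => f t * conjc (P t)), m; split => //; first by apply: cbmeasM => //;
  exact: cbmeasJ.
apply: filterS HP => i Hi.
have bh : cbmeas (fun t => f t - P t) by exact: cbmeasB.
apply: (@le_trans _ _ (av (fun t => C * cabs (f t - P t)) i)).
  apply: av_le.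
  - by apply: bmeas_cabs; apply: cbmeasB; apply: cbmeasM => //; exact: cbmeasJ.
  - by apply: bmeasM; [exact: bmeas_cst|exact: bmeas_cabs].
  move=> t; rewrite -mulrBr -rmorphB ComplexField.Normc.normcM.
  rewrite (_ : cabs (conjc _) = cabs (f t - P t)); first by rewrite ler_wpM2r// cabs_ge0.
  by case: (f t - P t) => x y /=; rewrite sqrrN.
rewrite avZ; last exact: bmeas_cabs.
apply: le_trans (ler_wpM2l C0 Hi) _.
by rewrite mulrCA ger_pMr// ler_pdivrMr ?ltr_wpDl// mul1r lerDl.
Qed.

(** Bessel's inequality is one half of [parsevalP]; approximation in mean square, obtained by
    truncation, is the other. *)
Lemma mean_approx_spectrum f : cbmeas f -> mean_approx f ->
  exists a M, spectrum f a M /\ parseval a M.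
Proof.
move=> bf fP.
have /choice[a Ha] : forall chi, exists m, dual_group chi ->
  mean (fun t => f t * conjc (chi t)) m.
  move=> chi; have [dc|ndc] := pselect (dual_group chi); last by exists 0.
  by have [m Hm] := mean_coeff bf fP dc; exists m.
have [M HM] := mean_sqr bf fP.
have sf : spectrum f a M by split.
exists a, M; split => //; apply/parsevalP; split; first by move=> s;
  exact: spectrum_bessel sf.
move=> e e0; have [P tP HP] := mean_approx2 bf fP e0.
exact: spectrum_trig_le sf tP HP.
Qed.

End folner_means.

(** * Uniform means along van Hove sequences *)

Section van_hove_spectra.
Local Open Scope complex_scope.
Context {R : realType} {G : topologicalZmodType}.
Context {theta : {measure set (borel G) -> \bar R}}.
Hypothesis hausdorffG : hausdorff_space G.
Hypothesis haar_theta : haar_measure theta.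
Implicit Types (x y u : G) (D E K W X : set G) (g h : G -> R) (A B : (set G)^nat).
Implicit Types (f P chi : G -> R[i]).
Local Notation Re := (@complex.Re R).
Local Notation Im := (@complex.Im R).
Local Notation vol := (vol theta).
Local Notation finite_vol := (@finite_vol R G theta).

Definition translates A (i : nat * G) : set G := translate i.2 (A i.1).

Local Notation tav A := (@av R G theta (nat * G)%type (translates A)).
Local Notation tmean X A := (@mean R G theta (nat * G)%type (translates_filter X)
  (translates A)).
Local Notation tspectrum X A :=
  (@spectrum R G theta (nat * G)%type (translates_filter X) (translates A)).

Section fixed_sequence.
Variables (A : (set G)^nat) (vA : van_hove theta A).

Lemma finite_vol_translates i : finite_vol (translates A i).
Proof. by apply: (finite_vol_translate haar_theta); exact: finite_vol_van_hove. Qed.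

Lemma vol_translates i : vol (translates A i) = vol (A i.1).
Proof. by apply: (vol_translate haar_theta);
  exact: (finite_vol_van_hove hausdorffG haar_theta _ vA).1. Qed.

Lemma vol_translates_gt0 i : 0 < vol (translates A i).
Proof. by rewrite vol_translates; exact: vol_van_hove_gt0. Qed.

(** By invariance the ratio does not depend on the translate, so the van Hove condition for the
    compact set [[set u]] gives the limit for every [X]. *)
Lemma translates_folner X u :
  (fun i => vol (translate u (translates A i) `\` translates A i) / vol (translates A i))
    @ translates_filter X --> (0 : R).
Proof.
apply/cvgrPdist_le => /= e e0; have /cvgrPdist_le := van_hove_cvg vA (@compact_set1 _ u).
move=> /(_ e e0); apply: filterS => n H x _; apply: le_trans H.
have fA := finite_vol_van_hove hausdorffG haar_theta n vA.
have cA := van_hove_precompact vA n.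
have fbd := finite_vol_van_hove_boundary hausdorffG haar_theta (@compact_set1 _ u) cA.
rewrite !sub0r !normrN vol_translates /= !ger0_norm ?divr_ge0 ?vol_ge0//.
rewrite ler_pM2r ?invr_gt0; last exact: vol_van_hove_gt0.
rewrite /translates /= translateD (addrC u) -translateD -translateDset.
rewrite (vol_translate haar_theta); last first.
  by apply: measurableD; [apply: borel_set_translate|]; exact: fA.1.
apply: le_vol => //; first by apply: measurableD; [apply: borel_set_translate|];
  exact: fA.1.
exact: translateD_sub_boundary.
Qed.

Lemma average_translatesE n x g :
  average theta (A n) (translate x (A n)) g = tav A g (n, x).
Proof. by rewrite /av /average vol_translates. Qed.

Lemma eaverage_translatesE n x g : bmeas g ->
  eaverage theta (A n) (translate x (A n)) g = (tav A g (n, x))%:E.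
Proof.
move=> bg; rewrite -average_translatesE /eaverage /average EFinM; congr (_ * _)%E.
rewrite /Rintegral fineK//.
have fA := finite_vol_translates (n, x).
by apply: integrable_fin_num; [exact: fA.1|exact: bmeas_integrable].
Qed.

End fixed_sequence.

(** * Translation of the notions of the theorem into limits along filters *)

Lemma cvg_translates0 (T : topologicalType) (p : nat * G -> T) (l : T) :
  p @ translates_filter [set 0] --> l <-> (fun n => p (n, 0)) @ \oo --> l.
Proof.
split=> H B /H; rewrite /translates_filter /nbhs /=.
  by apply: filterS => n; exact.
by apply: filterS => n Hn x ->.
Qed.

Lemma cvg_translates_sub (T : topologicalType) (p : nat * G -> T) (l : T) X Y :
  X `<=` Y -> p @ translates_filter Y --> l -> p @ translates_filter X --> l.
Proof. by move=> XY H B /H; exact: translates_filterS. Qed.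

Lemma cvg_uniform_translates (V : uniformType) (p : nat -> G -> V) (l : V) :
  {uniform, p @ \oo --> (fun=> l)} <->
  (fun i : nat * G => p i.1 i.2) @ translates_filter setT --> l.
Proof.
split.
  move=> H; apply/cvg_entourageP => E entE.
  have := H [set h | forall y, E (l, h y)].
  case.
    by apply/uniform_nbhs; exists E; split => // h Eh y; exact: Eh.
  by move=> N _ HN; exists N => // n Nn x _; exact: (HN n Nn x).
move=> /cvg_entourageP H Q /uniform_nbhs[E [entE EQ]].
have [N _ HN] := H E entE; exists N => // n Nn; apply: EQ => y _.
exact: (HN n Nn y I).
Qed.

Lemma limn_esup_lt (u : nat -> \bar R) (l : \bar R) :
  (limn_esup u < l)%E -> \forall n \near \oo, (u n < l)%E.
Proof.
move=> /ereal_inf_lt[_ [V FV <-]] supV; apply: filterS FV => n Vn.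
by apply: le_lt_trans supV; apply: ereal_sup_ubound; exists n.
Qed.

Lemma limn_esup_le (u : nat -> \bar R) (l : \bar R) :
  (\forall n \near \oo, (u n <= l)%E) -> (limn_esup u <= l)%E.
Proof.
move=> H; apply: ge_ereal_inf; exists (ereal_sup (u @` [set n | (u n <= l)%E])).
  by exists [set n | (u n <= l)%E].
by apply: ge_ereal_sup => _ [n /= ? <-].
Qed.

Lemma cbmeas_Lloc p f : cbmeas f -> Lloc theta p f.
Proof.
move=> bf; have [mf [M fM]] := (cbmeasP f).1 bf; split => // K cK.
have fK := compact_finite_vol hausdorffG haar_theta cK.
have := bmeas_integrable fK (bmeasX p (bmeas_cabs bf)).
move=> /integrable_lty; apply; exact: fK.1.
Qed.

Lemma cbmeas_sub_trig f P : cbmeas f -> trig_poly P -> cbmeas (fun t => f t - P t).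
Proof. by move=> bf tP; apply: cbmeasB => //; exact: trig_cbmeas. Qed.

Lemma weylP A f : van_hove theta A -> cbmeas f ->
  weyl_almost_periodic theta A f <->
  @mean_approx R G theta _ (translates_filter setT) (translates A) f.
Proof.
move=> vA bf; split=> [[_ H] e e0|H].
  have [P tP HP] := H e e0; exists P => //.
  apply: filterS (limn_esup_lt HP) => n Hn x _.
  rewrite -lee_fin -eaverage_translatesE//; last by apply: bmeas_cabs;
    exact: cbmeas_sub_trig.
  by apply: ltW; apply: le_lt_trans Hn; apply: ereal_sup_ubound; exists x.
split; first exact: cbmeas_Lloc.
(* Suprema and limits superior preserve weak inequalities, so [e / 2] leaves room for the strict
   one. *)
move=> e e0; have [P tP HP] := H (e / 2) (divr_gt0 e0 (ltr0n _ 2)); exists P => //.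
apply: (@le_lt_trans _ _ (e / 2)%:E); last by rewrite lte_fin; lra.
have [N _ HN] := HP; apply: limn_esup_le; exists N => // n Nn; have Hn := HN n Nn.
apply: ge_ereal_sup => _ [x _ <-].
rewrite eaverage_translatesE//; last by apply: bmeas_cabs; exact: cbmeas_sub_trig.
by rewrite lee_fin; exact: Hn.
Qed.

Lemma besicovitch2P B f : van_hove theta B -> cbmeas f ->
  besicovitch2_almost_periodic theta B f <->
  @mean2_approx R G theta _ (translates_filter [set 0]) (translates B) f.
Proof.
move=> vB bf.
have sE P n : trig_poly P ->
    sqrte (eaverage theta (B n) (B n) (fun t => cabs (f t - P t) ^+ 2)) =
    (Num.sqrt (tav B (fun t => cabs (f t - P t) ^+ 2) (n, 0)))%:E.
  move=> tP; have := eaverage_translatesE vB n 0 (bmeas_cabs_sqr (cbmeas_sub_trig bf tP)).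
  by rewrite translate0 => ->.
have a0 P i : trig_poly P -> 0 <= tav B (fun t => cabs (f t - P t) ^+ 2) i.
  move=> tP; apply: av_ge0.
  - exact: finite_vol_translates.
  - exact: vol_translates_gt0.
  - by apply: bmeas_cabs_sqr; exact: cbmeas_sub_trig.
  - by move=> t; exact: sqr_ge0.
split=> [[_ H] e e0|H].
  have se0 : 0 < Num.sqrt e by rewrite sqrtr_gt0.
  have [P tP HP] := H _ se0.
  exists P => //; apply: filterS (limn_esup_lt HP) => n Hn x ->.
  by move: Hn; rewrite sE// lte_fin ltr_sqrt// => /ltW.
split; first exact: cbmeas_Lloc.
move=> e e0; have e20 : 0 < e / 2 by rewrite divr_gt0.
have [P tP HP] := H ((e / 2) ^+ 2) (exprn_gt0 2 e20); exists P => //.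
apply: (@le_lt_trans _ _ (e / 2)%:E); last by rewrite lte_fin; lra.
have [N _ HN] := HP; apply: limn_esup_le; exists N => // n Nn; have Hn := HN n Nn.
rewrite sE// lee_fin -(ger0_norm (ltW e20)) -sqrtr_sqr ler_wsqrtr//.
exact: Hn.
Qed.

Lemma uniform_meanP A g (M : R) : van_hove theta A ->
  uniform_mean theta A g M <-> tav A g @ translates_filter setT --> M.
Proof.
move=> vA; rewrite /uniform_mean cvg_uniform_translates.
rewrite (_ : (fun i => _) = tav A g)//; apply/funext => -[n x].
by rewrite /= average_translatesE.
Qed.

Lemma uniform_cmeanP A f (m : R[i]) : van_hove theta A ->
  uniform_cmean theta A f m <-> tmean setT A f m.
Proof.
move=> vA; rewrite /uniform_cmean cvg_uniform_translates complexo_cvg /mean.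
have E g : (fun i : nat * G => average theta (A i.1) (translate i.2 (A i.1)) g) = tav A g.
  by apply/funext => -[n x]; rewrite /= average_translatesE.
by rewrite /= !E.
Qed.

Lemma cvg_averageP B g (M : R) : van_hove theta B ->
  average theta (B n) (B n) g @[n --> \oo] --> M <->
  tav B g @ translates_filter [set 0] --> M.
Proof.
move=> vB; rewrite cvg_translates0.
rewrite (_ : (fun n => tav B g (n, 0)) = (fun n => average theta (B n) (B n) g))//.
by apply/funext => n; rewrite -average_translatesE// translate0.
Qed.

Lemma cvg_caverageP B f (m : R[i]) : van_hove theta B ->
  caverage theta (B n) (B n) f @[n --> \oo] --> (m : R[i]^o) <->
  tmean [set 0] B f m.
Proof. by move=> vB; rewrite complexo_cvg /= !cvg_averageP. Qed.

Lemma uniform_parsevalP A f : van_hove theta A -> cbmeas f ->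
  uniform_parseval theta A f <-> exists a M, tspectrum setT A f a M /\ parseval a M.
Proof.
move=> vA bf; split=> [[a [M [Ha HM pa]]]|[a [M [[_ Ha HM] pa]]]]; exists a, M.
  split => //; split => //; last exact/uniform_meanP.
  by move=> chi /Ha /uniform_cmeanP; exact.
split => //; last exact/uniform_meanP.
by move=> chi /Ha ?; exact/uniform_cmeanP.
Qed.

Lemma mean_parsevalP B f : van_hove theta B -> cbmeas f ->
  mean_parseval theta B f <-> exists a M, tspectrum [set 0] B f a M /\ parseval a M.
Proof.
move=> vB bf; split=> [[a [M [Ha HM pa]]]|[a [M [[_ Ha HM] pa]]]]; exists a, M.
  split => //; split => //; last exact/cvg_averageP.
  by move=> chi /Ha /cvg_caverageP; exact.
split => //; last exact/cvg_averageP.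
by move=> chi /Ha ?; exact/cvg_caverageP.
Qed.

Lemma tmean_independent A B f m : van_hove theta A -> van_hove theta B -> cbmeas f ->
  tmean setT A f m -> tmean setT B f m.
Proof.
have E C g : van_hove theta C -> tav C g = @tavg R G theta C g.
  by move=> vC; apply/funext => -[n x]; rewrite -average_translatesE.
move=> vA vB [fr fi]; rewrite /mean !E// => -[mr mi].
by split; [exact: (mean_independent hausdorffG haar_theta vA vB fr mr)|
           exact: (mean_independent hausdorffG haar_theta vA vB fi mi)].
Qed.

(** * Uniformity from means along all van Hove sequences *)

Lemma van_hove_boundary_translate x K D :
  van_hove_boundary K (translate x D) = translate x (van_hove_boundary K D).
Proof.
have E (op : G -> G -> G) D' : (forall a k, op (x + a) k = x + op a k) ->
    [set op a k | a in translate x D' & k in K] = translate x [set op a k |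
      a in D' & k in K].
  move=> opx; apply/seteqP; split => [_ [_ [a Da <-] [k Kk <-]]|
    _ [_ [a Da [k Kk <-]] <-]].
    by exists (op a k); [exists a => //; exists k|rewrite opx].
  by exists (x + a); [exists a|exists k].
rewrite /van_hove_boundary -translateC (E (fun a k => a + k)); last by move=> *;
  rewrite addrA.
rewrite (E (fun a k => a - k)); last by move=> *; rewrite addrA.
by rewrite !closure_translate !translateE.
Qed.

(** The condition [k <= n k] forces [n k] to infinity, and translating changes neither the volume of
    a member nor that of its boundary. *)
Lemma van_hove_translate_seq A (n : nat -> nat) (x : nat -> G) : van_hove theta A ->
  (forall k, (k <= n k)%N) -> van_hove theta (fun k => translate (x k) (A (n k))).
Proof.
move=> vA nk; split=> [k|k|k|K cK].
- by apply: open_translate; exact: (van_hove_open vA).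
- by apply: precompact_translate; exact: (van_hove_precompact vA).
- have fA := finite_vol_van_hove hausdorffG haar_theta (n k) vA.
  by rewrite (haar_translate haar_theta _ fA.1); exact: (van_hove_gt0 vA).
- rewrite (_ : (fun k => _) =
  (fun k => vol (van_hove_boundary K (A k)) / vol (A k)) \o n).
    apply: cvg_comp (van_hove_cvg vA cK) => P [N _ NP].
    by exists N => // k /= Nk; apply: NP => /=; exact: leq_trans Nk (nk k).
  apply/funext => k /=; have fA := finite_vol_van_hove hausdorffG haar_theta (n k) vA.
  have fbd := finite_vol_van_hove_boundary hausdorffG haar_theta cK
    (van_hove_precompact vA (n k)).
  by rewrite van_hove_boundary_translate !(vol_translate haar_theta)//;
    [exact: fA.1|exact: fbd.1].
Qed.

(* Otherwise, alternating [A k] with translates of members of [A] on which the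
   average stays away from its limit gives a van Hove sequence without mean. *)
Lemma uniform_of_all_means A g : van_hove theta A -> bmeas g ->
  (forall B, van_hove theta B ->
    exists l, tav B g @ translates_filter [set 0] --> (l : R)) ->
  exists l, tav A g @ translates_filter setT --> (l : R).
Proof.
move=> vA bg H; have [l Al] := H A vA; exists l.
apply/cvgrPdist_le => /= e e0; apply: contrapT => nH.
have /choice[p Hp] : forall N, exists p : nat * G, (N <= p.1)%N /\ e < `|l - tav A g p|.
  move=> N; apply: contrapT => nN; apply: nH; exists N => // n Nn x _.
  by rewrite leNgt; apply/negP => lt; apply: nN; exists (n, x).
pose n k := if odd k then (p k).1 else k.
pose x k := if odd k then (p k).2 else 0.
have nk k : (k <= n k)%N by rewrite /n; case: ifP => // _; have [] := Hp k.
have vB := van_hove_translate_seq x vA nk.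
have BE k : tav (fun k => translate (x k) (A (n k))) g (k, 0) = tav A g (n k, x k).
  by rewrite /av /translates /= translate0.
have [l' Bl] := H _ vB.
have e30 : 0 < e / 3 by rewrite divr_gt0.
move/cvgrPdist_lt : Al => /(_ _ e30) [N1 _ HN1].
move/cvgrPdist_lt : Bl => /(_ _ e30) [N2 _ HN2].
(* At this even index the member is [A k], at the next one a bad translate. Comparing [l], the two
   averages and [l'] within [e / 3] each contradicts the choice of [p]. *)
pose k := (maxn N1 N2).*2.
have k1 : (N1 <= k)%N by rewrite /k -addnn (leq_trans (leq_maxl N1 N2)) ?leq_addr.
have k2 : (N2 <= k)%N by rewrite /k -addnn (leq_trans (leq_maxr N1 N2)) ?leq_addr.
have h1 := HN1 k k1 0 erefl.
have h2 := HN2 k k2 0 erefl; rewrite BE /n /x odd_double /= in h2.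
have h3 := HN2 k.+1 (leqW k2) 0 erefl;
  rewrite BE /n /x /= odd_double /= -surjective_pairing in h3.
have [_ h4] := Hp k.+1.
move: h1 h2 h3; rewrite !ltr_norml => /andP[? ?] /andP[? ?] /andP[? ?].
by move: h4; rewrite ltNge => /negP; apply; rewrite ler_norml; apply/andP; split; lra.
Qed.

Lemma uniform_cmean_of_all A f : van_hove theta A -> cbmeas f ->
  (forall B, van_hove theta B -> exists m, tmean [set 0] B f m) ->
  exists m, tmean setT A f m.
Proof.
move=> vA [fr fi] H.
have [|lr hr] := uniform_of_all_means vA fr.
  by move=> B /H[m [mr _]]; exists (Re m).
have [|li hi] := uniform_of_all_means vA fi.
  by move=> B /H[m [_ mi]]; exists (Im m).
by exists (lr +i* li).
Qed.

(** The plain limits along [A] satisfy Parseval's identity. The uniform limits exist by interleaving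
    and, restricted to the trivial translate, must coincide with them. *)
Lemma uniform_spectrum_of_all A f : van_hove theta A -> cbmeas f ->
  (forall B, van_hove theta B -> exists a M, tspectrum [set 0] B f a M /\ parseval a M) ->
  exists a M, tspectrum setT A f a M /\ parseval a M.
Proof.
move=> vA bf H; have [a [M [[_ fa fM] pa]]] := H A vA; exists a, M; split => //;
  split => //.
- move=> chi dc; have bfc : cbmeas (fun t => f t * conjc (chi t)).
    by apply: cbmeasM => //; apply: cbmeasJ; exact: dual_cbmeas.
  have [|m [mr mi]] := uniform_cmean_of_all vA bfc.
    by move=> B /H[b [N [[_ fb _] _]]]; exists (b chi); exact: fb.
  have m0 : tmean [set 0] A (fun t => f t * conjc (chi t)) m.
    by split; apply: (@cvg_translates_sub _ _ _ _ setT).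
  by rewrite (mean_unique (fa chi dc) m0).
- have [|l hl] := uniform_of_all_means vA (bmeas_cabs_sqr bf).
    by move=> B /H[b [N [[_ _ fN] _]]]; exists N.
  have l0 : tav A (fun t => cabs (f t) ^+ 2) @ translates_filter [set 0] --> l.
    by apply: (@cvg_translates_sub _ _ _ _ setT).
  by rewrite (cvg_unique _ fM l0).
Qed.

Lemma tspectrum_of_approx X A f : van_hove theta A ->
  ProperFilter (translates_filter X) -> cbmeas f ->
  @mean_approx R G theta _ (translates_filter X) (translates A) f ->
  exists a M, tspectrum X A f a M /\ parseval a M.
Proof.
move=> vA FF bf; apply: mean_approx_spectrum => //.
- exact: finite_vol_translates.
- exact: vol_translates_gt0.
- exact: translates_folner.
Qed.

Lemma tspectrum_approx X A f a M : van_hove theta A ->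
  ProperFilter (translates_filter X) ->
  tspectrum X A f a M -> parseval a M ->
  @mean2_approx R G theta _ (translates_filter X) (translates A) f.
Proof.
move=> vA FF sf pa e e0; apply: spectrum_approx sf pa e0 => //.
- exact: finite_vol_translates.
- exact: vol_translates_gt0.
- exact: translates_folner.
Qed.

Lemma tmean2_approxW X A f : van_hove theta A ->
  ProperFilter (translates_filter X) -> cbmeas f ->
  @mean2_approx R G theta _ (translates_filter X) (translates A) f ->
  @mean_approx R G theta _ (translates_filter X) (translates A) f.
Proof.
move=> vA FF bf; apply: mean2_approxW => //.
- exact: finite_vol_translates.
- exact: vol_translates_gt0.
Qed.

Lemma spectrum_independent A B f a M : van_hove theta A -> van_hove theta B -> cbmeas f ->
  tspectrum setT A f a M -> tspectrum setT B f a M.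
Proof.
move=> vA vB bf [_ fa fM]; split => // [chi dc|].
  apply: tmean_independent (fa chi dc) => //.
  by apply: cbmeasM => //; apply: cbmeasJ; exact: dual_cbmeas.
(* The squared modulus is viewed as a complex function with zero imaginary part, so that the
   independence of complex means applies. *)
have b2 : cbmeas (fun t => (cabs (f t) ^+ 2)%:C).
  by split; [exact: bmeas_cabs_sqr|exact: bmeas_cst].
have fM' : tmean setT A (fun t => (cabs (f t) ^+ 2)%:C) M%:C.
  split => //=; apply: cvg_near_cst; apply: nearW => i.
  by rewrite av_cst//; [exact: finite_vol_translates|exact: vol_translates_gt0].
exact: (tmean_independent vA vB b2 fM').1.
Qed.

End van_hove_spectra.

(** * The equivalences and amenability *)

Theorem proposition5p11 (R : realType) (G : topologicalZmodType)
    (hausdorffG : hausdorff_space G)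
    (locally_compactG : locally_compact [set: G])
    (sigma_compactG : sigma_compact G)
    (theta : {measure set (borel G) -> \bar R})
    (haar_theta : haar_measure theta)
    (f : G -> R[i]) (mf : cmeasurable f) (bf : cbounded f)
    (A : (set G)^nat) (vhA : van_hove theta A) :
  [<-> weyl_almost_periodic theta A f;
       uniform_parseval theta A f;
       forall B : (set G)^nat, van_hove theta B -> mean_parseval theta B f;
       forall B : (set G)^nat, van_hove theta B ->
         besicovitch2_almost_periodic theta B f]
  /\ (weyl_almost_periodic theta A f -> amenable theta f).
Proof.
have cbf : cbmeas f by apply/cbmeasP.
have weyl_spectrum : weyl_almost_periodic theta A f ->
    exists a M, spectrum (theta := theta) (F := translates_filter setT) (S :=
      translates A) f a M /\ parseval a M.
  move=> /(weylP hausdorffG haar_theta vhA cbf).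
  exact: (tspectrum_of_approx hausdorffG haar_theta).
split; last first.
  (* The mean is the Fourier--Bohr coefficient at the trivial character, and it is carried over from
     [A] to [B]. *)
  move=> /weyl_spectrum[a [M [[_ fa _] _]]]; split => // B vB; exists (a (fun=> 1)).
  apply/(uniform_cmeanP hausdorffG haar_theta _ _ vB).
  apply: (tmean_independent hausdorffG haar_theta vhA vB cbf).
  have := fa _ (@dual1 R G); congr mean; apply/funext => t.
  by rewrite conjc1 mulr1.
tfae.
- by move=> /weyl_spectrum; apply: (uniform_parsevalP hausdorffG haar_theta vhA cbf).2.
(* The uniform means along [A] are uniform means along [B] with the same values, so Parseval's
   identity survives restriction to the trivial translate. *)
- move=> /(uniform_parsevalP hausdorffG haar_theta vhA cbf)[a [M [sf pa]]] B vB.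
  apply/(mean_parsevalP hausdorffG haar_theta vB cbf); exists a, M; split => //.
  have [_ fa fM] := spectrum_independent hausdorffG haar_theta vhA vB cbf sf.
  split => // [chi /fa[mr mi]|]; last exact: (cvg_translates_sub _ fM).
  by split; [exact: (cvg_translates_sub _ mr)|exact: (cvg_translates_sub _ mi)].
- move=> H B vB; apply/(besicovitch2P hausdorffG haar_theta vB cbf).
  have [a [M [sf pa]]] := (mean_parsevalP hausdorffG haar_theta vB cbf).1 (H B vB).
  exact: (tspectrum_approx hausdorffG haar_theta vB _ sf pa).
(* Approximation along each [B] gives Parseval's identity there, hence uniform limits with
   Parseval's identity along [A], and these give approximation uniform over translates. *)
- move=> H; apply/(weylP hausdorffG haar_theta vhA cbf).
  have [|a [M [sf pa]]] := uniform_spectrum_of_all hausdorffG haar_theta vhA cbf.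
    move=> B vB; apply: (tspectrum_of_approx hausdorffG haar_theta) => //.
    apply: (tmean2_approxW hausdorffG haar_theta) => //.
    by apply/(besicovitch2P hausdorffG haar_theta vB cbf); exact: H.
  apply: (tmean2_approxW hausdorffG haar_theta) => //.
  exact: (tspectrum_approx hausdorffG haar_theta vhA _ sf pa).
Qed.
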